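(* For integers $k,c\ge 1$ let \[x_{k,c}=\liminf\Big\{\frac{\alpha_c(G)}{|V(G)|}\colon \operatorname{tw}(G)=k\Big\}.\] Then each of the following holds. (1) $\frac{c}{k+c+1}\le x_{k,c}\le \frac{c}{k+c}$ for every $c,k\ge 1$. (2) $x_{1,c}=\frac{c}{1+c}$ for every $c\ge 1$. (3) $x_{k,1}=\frac{1}{k+1}$ and $x_{k,2}=\frac{2}{k+2}$ for every $k\ge 1$. (4) $x_{2,3}=\frac59$.
   Context: All graphs are finite, simple and undirected. For a graph $G=(V,E)$ and a positive integer $c$, a set $S\subseteq V$ is a $c$-clustered set if every connected component of the induced subgraph $G[S]$ has at most $c$ vertices; $\alpha_c(G)$ denotes the maximum size of a $c$-clustered set in $G$. $\operatorname{tw}(G)$ denotes the treewidth of $G$. The quantity $x_{k,c}$ is the limit inferior, as the number of vertices grows, of the ratio $\alpha_c(G)/|V(G)|$ over graphs $G$ of treewidth exactly $k$ (i.e. the largest proportion of vertices that can be guaranteed in a $c$-clustered set of every large graph of treewidth $k$). *)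

(* Defs.v *)
From HB Require Import structures.
From mathcomp Require Import all_boot all_order all_algebra.
From mathcomp Require Import boolp classical_sets reals ereal sequences.
Set Implicit Arguments.
Unset Strict Implicit.
Unset Printing Implicit Defensive.

Local Open Scope nat_scope.

Record sgraph := SGraph {
  vertex :> finType;
  adj : rel vertex;
  adj_sym : symmetric adj;
  adj_irrefl : irreflexive adj }.

Section Induced.
Variables (G : sgraph) (S : {set G}).

Definition induced_adj : rel {x : G | x \in S} :=
  [rel x y | adj (val x) (val y)].

Fact induced_adj_sym : symmetric induced_adj.
Proof. by move=> x y; apply: adj_sym. Qed.

Fact induced_adj_irrefl : irreflexive induced_adj.
Proof. by move=> x; apply: adj_irrefl. Qed.

Definition induced : sgraph := SGraph induced_adj_sym induced_adj_irrefl.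

End Induced.

Definition component (G : sgraph) (x : G) : {set G} :=
  [set y | connect (@adj G) x y].

Definition clustered (G : sgraph) (c : nat) (S : {set G}) : bool :=
  [forall x : induced S, #|component x| <= c].

Definition alpha (c : nat) (G : sgraph) : nat :=
  \max_(S : {set G} | clustered c S) #|S|.

Definition connected (G : sgraph) : Prop :=
  forall x y : G, connect (@adj G) x y.

(* A pair of adjacent vertices x, y satisfies [ucycle adj [:: x; y]], so only
   duplicate-free closed walks of length at least 3 are graph cycles. *)
Definition acyclic (G : sgraph) : Prop :=
  forall p : seq G, ucycle (@adj G) p -> size p < 3.

Definition is_tree (T : sgraph) : Prop :=
  [/\ 0 < #|T|, connected T & acyclic T].

Definition tree_decomposition (G T : sgraph) (B : T -> {set G}) : Prop :=
  [/\ is_tree T,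
      forall v : G, exists t : T, v \in B t,
      forall u v : G, adj u v -> exists t : T, (u \in B t) && (v \in B t)
    & forall v : G, connected (induced [set t : T | v \in B t])].

Definition width (G T : sgraph) (B : T -> {set G}) : nat :=
  (\max_(t : T) #|B t|).-1.

Definition has_decomposition_of_width (G : sgraph) (w : nat) : Prop :=
  exists (T : sgraph) (B : T -> {set G}), tree_decomposition B /\ width B = w.

Fact single_sym : symmetric (fun _ _ : unit => false). Proof. by []. Qed.
Fact single_irrefl : irreflexive (fun _ : unit => xpred0 : pred unit).
Proof. by []. Qed.
Definition single : sgraph := SGraph single_sym single_irrefl.

Lemma ex_decomposition (G : sgraph) :
  exists w, `[< has_decomposition_of_width G w >].
Proof.
exists (width (fun _ : single => [set: G])); apply/asboolP.
exists single, (fun=> [set: G]); split=> //; split.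
- split; first by rewrite card_unit.
  + by move=> [] []; apply: connect0.
  + by case=> [|[] [|[] p]].
- by move=> v; exists tt; rewrite inE.
- by move=> u v _; exists tt; rewrite !inE.
- move=> v [[] x] [[] y].
  by rewrite (bool_irrelevance x y); apply: connect0.
Qed.

(* Truncated predecessor in [width]: the graph with no vertices gets
   treewidth 0 instead of -1. *)
Definition treewidth (G : sgraph) : nat := ex_minn (ex_decomposition G).

Local Open Scope ring_scope.
Local Open Scope classical_set_scope.

Definition ratios (R : realType) (k c n : nat) : set (\bar R) :=
  [set r | exists G : sgraph,
     [/\ #|G| = n, treewidth G = k & r = ((alpha c G)%:R / n%:R)%:E]].
Arguments ratios : clear implicits.

(* The liminf is taken as the number n of vertices tends to infinity.  For
   n <= k no graph on n vertices has treewidth k, and the infimum of the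
   empty set is +oo. *)
Definition xkc (R : realType) (k c : nat) : \bar R :=
  limn_einf (fun n : nat => ereal_inf (ratios R k c n)).
Arguments xkc : clear implicits.

(* Main.v *)
Require Import Defs.
From mathcomp Require Import boolp classical_sets reals ereal topology sequences.
From mathcomp Require Import all_boot all_order all_algebra.
From mathcomp Require Import zify.

(** Lower bounds.  A tree decomposition of width k is turned into a vertex
    elimination process: at any time a set C of eliminated vertices sees the
    rest of the graph only through a bag B of at most k + 1 vertices.  For the
    general bound, for trees and for c = 1 one keeps C entirely and deletes a
    bag as soon as C is large enough, and recurses on the rest.

    For c = 2 one records how much is lost inside C when some vertices of the
    bag are kept.  This loss is dominated by a sum of two kinds of atoms, placed
    on vertices and on subsets of the bag, whose total price never exceeds the
    surplus (k + 2) F - 2 #|C|, where F vertices of C can be kept; so the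
    surplus is nonnegative at the end.  The bound 5/9 for k = 2, c = 3 is
    obtained in the same way, with other prices, by first deleting a bag
    whenever the surplus 9 F - 5 #|C| pays for it.

    Upper bounds.  In the k-th power of a path on k + c vertices any c + 1
    vertices induce a connected subgraph, so disjoint copies have ratio
    c / (k + c).  For 5/9 one takes the square of a long path and adds, for
    every seven consecutive vertices s0, ..., s6, a vertex adjacent to s0, s2
    and a vertex adjacent to s1, s3; a 3-clustered set contains at most 5 of
    the 9 vertices of a block, up to a bounded error carried along the path. *)

Set Implicit Arguments.
Unset Strict Implicit.
Unset Printing Implicit Defensive.

Local Open Scope nat_scope.

(** * Clustered sets and elimination *)

Section Clustered.
Variable G : sgraph.
Implicit Types (A B S R U X C D W N : {set G}) (c j k p q : nat).

Definition radj S : rel G := [rel x y | [&& adj x y, x \in S & y \in S]].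

Definition separated A B := forall x y, x \in A -> y \in B -> ~~ adj x y.

Lemma separatedS A B A' B' :
  A' \subset A -> B' \subset B -> separated A B -> separated A' B'.
Proof. by move=> /subsetP sA /subsetP sB h x y /sA xA /sB; apply: h. Qed.

Lemma separatedC A B : separated A B -> separated B A.
Proof. by move=> h x y xB yA; rewrite adj_sym; apply: h. Qed.

Lemma separatedUl A B C : separated A C -> separated B C -> separated (A :|: B) C.
Proof. by move=> hA hB x y /setUP[] xA yC; [apply: hA|apply: hB]. Qed.

Lemma separatedUr A B C : separated C A -> separated C B -> separated C (A :|: B).
Proof. by move=> hA hB; apply/separatedC/separatedUl; apply: separatedC. Qed.

Lemma separated0 A : separated set0 A. Proof. by move=> x y; rewrite inE. Qed.

Lemma connect_induced S (x y : induced S) :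
  connect (@adj (induced S)) x y = connect (radj S) (val x) (val y).
Proof.
apply/idP/idP.
  case/connectP=> p; elim: p x => [|z p IHp] x /=; first by move=> _ ->.
  case/andP=> xz zp yE; apply: connect_trans (IHp _ zp yE); apply: connect1.
  by rewrite /radj /= (valP x) (valP z) !andbT.
case/connectP=> p; elim: p x => [|z p IHp] x /=; first by move=> _ /val_inj ->.
case/andP=> /and3P[xz _ zS] zp yE.
apply: connect_trans (IHp (Sub z zS) zp yE); exact: connect1.
Qed.

Lemma clusteredP c S :
  reflect (forall x, x \in S -> #|[set y | connect (radj S) x y]| <= c)
          (clustered c S).
Proof.
have cmpE (x : induced S) :
    #|component x| = #|[set y | connect (radj S) (val x) y]|.
  rewrite -(card_imset _ val_inj); apply: eq_card => y; rewrite inE.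
  apply/imsetP/idP=> [[z + ->]|]; first by rewrite inE connect_induced.
  move=> xy; have yS : y \in S.
    case/connectP: xy => p; case/lastP: p => [|p z] /=.
      by move=> _ ->; apply: valP.
    by rewrite rcons_path last_rcons => /andP[_ /and3P[_ _ zS]] ->.
  by exists (Sub y yS); rewrite // inE connect_induced.
apply: (iffP forallP) => [h x xS|h x]; last by rewrite cmpE; apply/h/valP.
by have := h (Sub x xS); rewrite cmpE.
Qed.

Lemma clustered_small c S : #|S| <= c -> clustered c S.
Proof.
move=> Sc; apply/clusteredP=> x xS; apply: leq_trans Sc; apply/subset_leq_card.
apply/subsetP=> y; rewrite inE => /connectP[p].
case/lastP: p => [|p z] /=; first by move=> _ ->.
by rewrite rcons_path last_rcons => /andP[_ /and3P[_ _ zS]] ->.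
Qed.

Lemma connect_radjU A B x y : separated A B -> x \in A ->
  connect (radj (A :|: B)) x y -> connect (radj A) x y.
Proof.
move=> sAB xA /connectP[p]; elim: p x xA => [|z p IHp] x xA /=.
  by move=> _ ->.
case/andP=> /and3P[xz _ /setUP zAB] zp yE.
have zA : z \in A.
  by case: zAB => // zB; have := sAB _ _ xA zB; rewrite xz.
apply: connect_trans (IHp _ zA zp yE).
by apply: connect1; rewrite /radj /= xz xA zA.
Qed.

Lemma clusteredU c A B :
  clustered c A -> clustered c B -> separated A B -> clustered c (A :|: B).
Proof.
move=> /clusteredP cA /clusteredP cB sAB; apply/clusteredP=> x /setUP[] xA.
  apply: leq_trans (cA x xA); apply/subset_leq_card/subsetP=> y.
  by rewrite !inE; apply: connect_radjU.
apply: leq_trans (cB x xA); apply/subset_leq_card/subsetP=> y.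
by rewrite !inE setUC; apply: connect_radjU => //; apply: separatedC.
Qed.

(** A path stays in one component. Every upper bound on clustered sets below rests on this. *)
Lemma clustered_path c S x (s : seq G) : clustered c S ->
  path (@adj G) x s -> uniq (x :: s) -> {subset x :: s <= S} ->
  size (x :: s) <= c.
Proof.
move=> /clusteredP cS xs Ux sS.
apply: leq_trans (cS x _); last by apply: sS; rewrite inE eqxx.
rewrite cardE; apply: uniq_leq_size => // y ys; rewrite mem_enum inE.
have {Ux} : path (radj S) x s.
  elim: s x xs sS {ys Ux} => //= z s IHs x /andP[xz zs] sS.
  rewrite /radj /= xz !sS ?inE ?eqxx ?orbT //=; apply: IHs => // u us.
  by apply: sS; rewrite inE us orbT.
by move/path_connect=> /(_ y); apply.
Qed.

(* [C] consists of eliminated vertices: inside [W], their neighbours lie in [C]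
   or in the current bag [B]. *)
Inductive bag k W : {set G} -> {set G} -> Prop :=
| BagNil B : B \subset W -> #|B| <= k.+1 -> bag k W B set0
| BagJoin B C D : bag k W B C -> bag k W B D -> [disjoint C & D] ->
    separated C D -> bag k W B (C :|: D)
| BagForget B C w : bag k W B C -> w \in B ->
    separated (w |: C) (W :\: (B :|: C)) -> bag k W (B :\ w) (w |: C)
| BagWeaken B B' C : bag k W B C -> B \subset B' -> B' \subset W ->
    #|B'| <= k.+1 -> [disjoint B' & C] -> bag k W B' C.

Lemma bag_facts k W B C : bag k W B C ->
  [/\ B \subset W, C \subset W, #|B| <= k.+1, [disjoint B & C]
    & separated C (W :\: (B :|: C))].
Proof.
elim=> {B C} [B BW Bk|B C D _ [BW CW Bk BC sC] _ [_ DW _ BD sD] CD sCD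
             |B C w _ [BW CW Bk BC sC] wB sw|B B' C _ [BW CW Bk BC sC] BB' B'W B'k B'C].
- split=> //; first exact: sub0set.
    by rewrite -setI_eq0 setI0.
  exact: separated0.
- split=> //; first by rewrite subUset CW.
    by rewrite -setI_eq0 setIUr setU_eq0 !setI_eq0 BC.
  apply: separatedUl; [apply: separatedS sC|apply: separatedS sD] => //.
    by rewrite setUA setDUr subsetIl.
  by rewrite (setUC C) setUA setDUr subsetIl.
- split=> //.
  + exact: subset_trans (subD1set _ _) BW.
  + by rewrite subUset sub1set (subsetP BW).
  + by apply: leq_trans Bk; apply/subset_leq_card/subD1set.
  + rewrite -setI_eq0 setIUr -subset0 subUset !subset0 setI_eq0.
    rewrite disjoint_sym disjoints1 !inE eqxx /= setI_eq0.
    by apply: disjointWl BC; apply: subD1set.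
  + apply: separatedS sw => //; apply: setDS; rewrite subUset.
    apply/andP; split; apply/subsetP=> z; rewrite !inE.
      by case: eqP => //= _ ->.
    by move=> ->; rewrite !orbT.
- split=> //; apply: separatedS sC => //; apply: setDS; exact: setSU.
Qed.

Definition chunk p q c W X S :=
  [/\ X != set0, X \subset W, S \subset X, clustered c S
    & separated S (W :\: X) /\ p * #|X| <= q * #|S|].

(** Strip chunks one after another. [S] has no neighbour in [W :\: X], so sets kept at different
    stages never merge into a larger cluster, and the inequalities add up. *)
Lemma greedy p q c W :
  (forall U, U \subset W -> U != set0 -> exists X S, chunk p q c U X S) ->
  exists S, [/\ S \subset W, clustered c S & p * #|W| <= q * #|S|].
Proof.
have [n] := ubnP #|W|; elim: n W => // n IHn W Wn h.
have [->|W0] := eqVneq W set0.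
  exists set0; split; rewrite ?sub0set ?cards0 ?muln0 //.
  by apply: clustered_small; rewrite cards0.
have [//|X [S [X0 XW SX cS [sS le]]]] := h W _ W0.
have cWX := cardsD W X; rewrite (setIidPr XW) in cWX.
have X_gt0 : 0 < #|X| by rewrite card_gt0.
have XleW := subset_leq_card XW.
case: (IHn (W :\: X)) => [||S' [S'W cS' le']].
- lia.
- move=> U UW; apply: h; exact: subset_trans UW (subsetDl _ _).
exists (S :|: S'); split.
- rewrite subUset (subset_trans SX XW) /=.
  exact: subset_trans S'W (subsetDl _ _).
- apply: clusteredU => //; exact: separatedS sS.
- have SS' : [disjoint S & S'].
    apply: disjointWl SX _; apply: disjointWr S'W _.
    by rewrite disjoint_sym disjoints_subset setDE subsetIr.
  rewrite cardsU (disjoint_setI0 SS') cards0 subn0.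
  rewrite mulnDr; apply: leq_trans (leq_add le le').
  by rewrite -mulnDr cWX subnKC.
Qed.

End Clustered.

(** * The bounds with c arbitrary or c = 1 *)

Section SimpleBounds.
Variable G : sgraph.
Implicit Types (A B S R U X C D W N : {set G}) (c j k p q : nat).

(** When [C] first reaches [c] vertices, it is a union of two separated sets of fewer than [c]
    vertices or one vertex larger than such a set, hence [c]-clustered. Deleting the bag then costs
    at most [k + 1] vertices. *)
Lemma bag_chunk_general k c W B C : 0 < c -> bag k W B C ->
  (exists X S, chunk c (k + c + 1) c W X S) \/ #|C| < c.
Proof.
move=> c0.
have big B' C' : bag k W B' C' -> clustered c C' -> c <= #|C'| ->
    exists X S, chunk c (k + c + 1) c W X S.
  move=> h cC cle; have [BW CW Bk BC sC] := bag_facts h.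
  exists (B' :|: C'), C'; split=> //.
  - by rewrite -card_gt0; apply: leq_trans (subset_leq_card (subsetUr _ _)); lia.
  - by rewrite subUset BW.
  - exact: subsetUr.
  - split=> //; rewrite cardsU (disjoint_setI0 BC) cards0 subn0; nia.
have fin B' C' : bag k W B' C' -> clustered c C' ->
    (exists X S, chunk c (k + c + 1) c W X S) \/ #|C'| < c.
  by move=> h cC; have [|/(big _ _ h cC)] := ltnP #|C'| c; [right|left].
elim=> {B C} [B _ _|B C D hC IC hD ID CD sCD|B C w h IC wB sw|B B' C _ IC _ _ _ _] //.
- by right; rewrite cards0.
- case: IC => [|Cc]; [by left|case: ID => [|Dc]; [by left|]].
  apply: (fin B); first exact: BagJoin.
  by apply: clusteredU => //; apply/clustered_small/ltnW.
- case: IC => [|Cc]; first by left.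
  apply: (fin (B :\ w)); first exact: BagForget.
  by apply: clustered_small; rewrite cardsU1; case: (w \in C) => /=; lia.
Qed.

(** The first forgotten vertex [w] has all its neighbours in the bag, so [w] is kept and the rest of
    the bag deleted. *)
Lemma bag_chunk_one k W B C : bag k W B C ->
  (exists X S, chunk 1 (k + 1) 1 W X S) \/ C = set0.
Proof.
elim=> {B C} [B _ _|B C D hC IC hD ID CD sCD|B C w h IC wB sw|B B' C _ IC _ _ _ _] //.
- by right.
- case: IC => [|->]; [by left|case: ID => [|->]; [by left|]].
  by right; rewrite setU0.
- case: IC => [|C0]; first by left.
  have [BW _ Bk _ _] := bag_facts h.
  left; exists B, [set w]; split=> //.
  + by apply/set0Pn; exists w.
  + by rewrite sub1set.
  + by apply: clustered_small; rewrite cards1.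
  + split; last by rewrite cards1; lia.
    by rewrite C0 !setU0 in sw.
Qed.

(* With bags of size two, the eliminated part splits into pieces hanging at a
   single vertex of the bag. *)
Definition hanging c W B C (f : G -> {set G}) :=
  C = \bigcup_(b in B) f b /\
  forall b, b \in B -> #|f b| < c /\ separated (f b) (W :\: (b |: f b)).

(** A piece [f b] is cut off by [b] alone, so once [c] vertices are reached only [b] has to be
    deleted. Forgetting one of two bag vertices makes everything hang at the other. *)
Lemma bag_chunk_tree c W B C : 0 < c -> bag 1 W B C ->
  (exists X S, chunk c (1 + c) c W X S) \/ exists f, hanging c W B C f.
Proof.
move=> c0.
have big b S : b \in W -> b \notin S -> S \subset W -> clustered c S ->
    separated S (W :\: (b |: S)) -> c <= #|S| ->
    exists X S, chunk c (1 + c) c W X S.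
  move=> bW bS SW cS sS Sc; exists (b |: S), S; split=> //.
  - by apply/set0Pn; exists b; rewrite setU11.
  - by rewrite subUset sub1set bW.
  - exact: subsetUr.
  - by split=> //; rewrite cardsU1 bS /=; nia.
elim=> {B C} [B _ _|B C D hC IC hD ID CD sCD|B C w h IC wB sw|B B' C h IC BB' B'W B'k B'C].
- right; exists (fun=> set0); split; first by rewrite big1.
  by move=> b _; rewrite cards0; split=> //; apply: separated0.
- case: IC => [|[f [fC ff]]]; [by left|case: ID => [|[g [gD gg]]]; [by left|]].
  have [BW CW Bk BC sC] := bag_facts hC; have [_ DW _ BD sD] := bag_facts hD.
  have fsub b : b \in B -> f b \subset C by move=> bB; rewrite fC; apply: bigcup_sup.
  have gsub b : b \in B -> g b \subset D by move=> bB; rewrite gD; apply: bigcup_sup.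
  have sfg b : b \in B -> separated (f b :|: g b) (W :\: (b |: (f b :|: g b))).
    move=> bB; apply: separatedUl;
      [apply: separatedS (ff b bB).2|apply: separatedS (gg b bB).2] => //;
      apply: setDS; apply: setUS; rewrite ?subsetUl ?subsetUr //.
  have [/existsP[b /andP[bB cb]]|/existsPn no] :=
      boolP [exists b, (b \in B) && (c <= #|f b :|: g b|)].
    left; apply: (big b (f b :|: g b)) => //.
    + exact: (subsetP BW).
    + rewrite inE negb_or; apply/andP; split; apply/negP.
        by move/(subsetP (fsub b bB)); apply/negP; rewrite (disjointFr BC).
      by move/(subsetP (gsub b bB)); apply/negP; rewrite (disjointFr BD).
    + rewrite subUset (subset_trans (fsub b bB) CW).
      by rewrite (subset_trans (gsub b bB) DW).
    + apply: clusteredU; try by apply/clustered_small/ltnW; have [] := ff b bB; have [] := gg b bB.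
      exact: separatedS (fsub b bB) (gsub b bB) sCD.
    + exact: sfg.
  right; exists (fun b => f b :|: g b); split.
    by rewrite big_split /= -fC -gD.
  move=> b bB; split; last exact: sfg.
  by have := no b; rewrite bB /= -ltnNge.
- case: IC => [|[f [fC ff]]]; first by left.
  have [BW CW Bk BC sC] := bag_facts h.
  have hF := BagForget h wB sw; have [_ wCW _ _ _] := bag_facts hF.
  have [fw sfw] := ff w wB.
  have cl : #|B :\ w| <= 1 by rewrite (cardsD1 w) wB in Bk; lia.
  (* If [w] is alone in the bag, [w |: C] has at most [c] vertices and no neighbour in the rest of
     [W]: all of it is kept. *)
  have [Bw0|[q qB]] := set_0Vmem (B :\ w).
    have Bw : B = [set w].
      by rewrite -(setD1K wB) Bw0 setU0.
    left; exists (w |: C), (w |: C); split=> //.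
    + by apply/set0Pn; exists w; rewrite setU11.
    + apply: clustered_small; rewrite fC Bw big_set1 cardsU1.
      by case: (w \notin f w) => /=; lia.
    + split; last by lia.
      by apply: separatedS sw => //; rewrite Bw.
  have Bwq : B :\ w = [set q].
    by apply/esym/eqP; rewrite eqEcard sub1set qB cards1.
  have Bwq2 : B = w |: [set q] by rewrite -(setD1K wB) Bwq.
  have qBB : q \in B by rewrite Bwq2 !inE eqxx orbT.
  have qw : q != w by have := qB; rewrite !inE => /andP[].
  have [fq sfq] := ff q qBB.
  have CE : C = f w :|: f q.
    by rewrite fC Bwq2 big_setU1 ?big_set1 //= inE eq_sym.
  have qC : q \notin C by rewrite (disjointFr BC).
  have qwC : q \notin w |: C by rewrite !inE negb_or qw.
  (* The pieces [f w] and [f q] may overlap; the common part goes to [f q], whose only neighbour in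
     [W] outside itself can be [q]. *)
  have wCE : w |: C = f q :|: ((w |: f w) :\: f q).
    by apply/setP=> z; rewrite CE !inE; case: (z \in f q); rewrite ?orbT ?orbF.
  have cwC : clustered c (w |: C).
    rewrite wCE; apply: clusteredU.
    + exact/clustered_small/ltnW.
    + apply: clustered_small; apply: leq_trans (subset_leq_card (subsetDl _ _)) _.
      by rewrite cardsU1; apply: leq_trans fw; rewrite -add1n leq_add2r leq_b1.
    + apply: separatedS sfq => //; apply/subsetP=> z; rewrite !inE.
      case/andP=> /negPf zq zw; rewrite zq orbF.
      have zwC : z \in w |: C by rewrite CE !inE; case/orP: zw => ->; rewrite ?orbT.
      rewrite (subsetP wCW) // andbT; apply: contraNneq qwC => <-; exact: zwC.
  have swC : separated (w |: C) (W :\: (q |: (w |: C))).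
    apply: separatedS sw => //; apply: setDS; rewrite Bwq2.
    by apply/subsetP=> z; rewrite !inE; case/orP => [/orP[]|] ->; rewrite ?orbT.
  have qW : q \in W := subsetP BW _ qBB.
  have [cle|clt] := leqP c #|w |: C|; first by left; apply: (big q (w |: C)).
  right; exists (fun b => w |: C); rewrite Bwq; split; first by rewrite big_set1.
  by move=> b; rewrite inE => /eqP->.
- case: IC => [|[f [fC ff]]]; first by left.
  right; exists (fun b => if b \in B then f b else set0); split.
    rewrite fC [RHS](big_setID B) /= (setIidPr BB') [X in _ :|: X]big1 ?setU0.
      by apply: eq_bigr => b ->.
    by move=> b; rewrite inE => /andP[/negPf-> _].
  move=> b _; case: ifP => [|_]; first exact: ff.
  by rewrite cards0; split=> //; apply: separated0.
Qed.

End SimpleBounds.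

(** * Kept vertices in a bag *)

Section Profiles.
Variable G : sgraph.
Implicit Types (A B S R U X C D W N M : {set G}) (c j k F : nat) (q w : G).
Implicit Types (d : {set G} -> nat -> nat) (x : G -> nat) (Ms : seq {set G}).

(* [R] is the part of the solution [S] that may share a cluster with the
   vertices of [X] kept in the bag. *)
Definition sol c C X j S R :=
  [/\ R \subset S, S \subset C, #|R| <= j, clustered c (S :\: R)
    & separated (R :|: X) (S :\: R)].

(** [d X j] bounds the loss against the target [F] when the bag vertices [X] are kept and [j]
    vertices of [C] may join them. All of these are budgeted as a single cluster, the worst case. *)
Definition profile c C B F d := forall X j, X \subset B -> #|X| + j <= c ->
  exists S R, sol c C X j S R /\ F <= #|S| + d X j.

Lemma profile_nil c B F d : (forall X j, F <= d X j) -> profile c set0 B F d.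
Proof.
move=> Fd X j _ _; exists set0, set0; split; last by rewrite cards0 add0n.
split; rewrite ?sub0set ?cards0 ?setD0 //.
  by apply: clustered_small; rewrite cards0.
exact/separatedC/separated0.
Qed.

Lemma profile_join c B C D F1 F2 d1 d2 d : [disjoint C & D] -> separated C D ->
  profile c C B F1 d1 -> profile c D B F2 d2 ->
  (forall X j, X \subset B -> exists j1 j2,
     j1 + j2 <= j /\ d1 X j1 + d2 X j2 <= d X j) ->
  profile c (C :|: D) B (F1 + F2) d.
Proof.
move=> CD sCD p1 p2 h X j XB Xj; have [j1 [j2 [jj dd]]] := h X j XB.
case: (p1 X j1) => [//||S1 [R1 [[RS1 SC1 R1j c1 s1] F1S]]]; first by lia.
case: (p2 X j2) => [//||S2 [R2 [[RS2 SC2 R2j c2 s2] F2S]]]; first by lia.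
have SS : [disjoint S1 & S2] by apply: disjointWl SC1 _; apply: disjointWr SC2 _.
have DE : (S1 :|: S2) :\: (R1 :|: R2) = (S1 :\: R1) :|: (S2 :\: R2).
  apply/setP=> z; rewrite !inE.
  case z1: (z \in S1).
    have z2 : z \in S2 = false by rewrite (disjointFr SS).
    by rewrite z2 (contraFF (subsetP RS2 z) z2) !andbF !orbF.
  by rewrite (contraFF (subsetP RS1 z) z1) andbF.
have D1 : S1 :\: R1 \subset C by apply: subset_trans SC1; apply: subsetDl.
have D2 : S2 :\: R2 \subset D by apply: subset_trans SC2; apply: subsetDl.
have C1 := subset_trans RS1 SC1; have C2 := subset_trans RS2 SC2.
exists (S1 :|: S2), (R1 :|: R2); split.
  rewrite /sol DE; split.
  - exact: setUSS.
  - exact: setUSS.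
  - by apply: leq_trans (leq_card_setU _ _) _; move: R1j R2j jj; clear; lia.
  - by apply: clusteredU => //; apply: separatedS sCD.
  - apply: separatedUr; apply: separatedUl; try by
      [apply: separatedS s1 => //; apply: subsetUr
      |apply: separatedS s2 => //; apply: subsetUr].
    + apply: separatedUl; first by apply: separatedS s1 => //; apply: subsetUl.
      by apply: separatedS (separatedC sCD).
    + apply: separatedUl; last by apply: separatedS s2 => //; apply: subsetUl.
      by apply: separatedS sCD.
by rewrite cardsU (disjoint_setI0 SS) cards0 subn0; move: F1S F2S dd; clear; lia.
Qed.

(** The alternatives for [w]: it is deleted; it is kept as one of the [j] vertices that may join
    [X]; or no bag vertex is kept and [w] closes a cluster with at most [c.-1] others. *)
Lemma profile_forget c B C w F d F' d' : 0 < c -> w \in B -> w \notin C ->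
  profile c C B F d ->
  (forall X j, X \subset B :\ w -> #|X| + j <= c ->
   [\/ F' + d X j <= F + d' X j,
       0 < j /\ F' + d (w |: X) j.-1 <= (F + d' X j).+1
     | X = set0 /\ F' + d [set w] c.-1 <= (F + d' X j).+1]) ->
  profile c (w |: C) (B :\ w) F' d'.
Proof.
move=> c0 wB wC pr h X j XB Xj.
have wS S : S \subset C -> w \notin S.
  by move=> SC; apply: contra wC => /(subsetP SC).
have wD S R : S \subset C -> (w |: S) :\: (w |: R) = S :\: R.
  move=> /wS wS'; apply/setP=> z; rewrite !inE; case: eqVneq => //= ->.
  by rewrite (negPf wS') andbF.
have XB' : X \subset B by apply: subset_trans XB (subD1set _ _).
have wX : w \notin X by apply/negP=> /(subsetP XB); rewrite !inE eqxx.
case: (h X j XB Xj) => [le|[j0 le]|[X0 le]].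
- have [S [R [[RS SC Rj cS sS] FS]]] := pr X j XB' Xj.
  exists S, R; split; last by lia.
  by split=> //; apply: subset_trans SC (subsetUr _ _).
- case: (pr (w |: X) j.-1) => [||S [R [[RS SC Rj cS sS] FS]]].
  + by rewrite subUset sub1set wB.
  + by rewrite cardsU1 wX /=; lia.
  exists (w |: S), (w |: R); split; last by rewrite cardsU1 wS //=; lia.
  rewrite /sol wD //; split=> //; try exact: setUS.
  + by rewrite cardsU1 wS ?(subset_trans RS) //=; lia.
  + apply: separatedS sS => //; apply/subsetP=> z; rewrite !inE.
    by case/orP=> [/orP[]|] ->; rewrite ?orbT.
- case: (pr [set w] c.-1) => [||S [R [[RS SC Rj cS sS] FS]]].
  + by rewrite sub1set.
  + by rewrite cards1; lia.
  exists (w |: S), set0; split; last by rewrite cardsU1 wS //=; lia.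
  split; rewrite ?sub0set ?cards0 ?setD0 //; last 1 first.
  + by rewrite X0 setU0; apply: separated0.
  + exact: setUS.
  have -> : w |: S = (w |: R) :|: (S :\: R).
    apply/setP=> z; rewrite !inE; have := subsetP RS z.
    by case: (z \in R) => [->//|_]; rewrite orbF.
  apply: clusteredU => //.
  + by apply: clustered_small; rewrite cardsU1 wS ?(subset_trans RS) //=; lia.
  + by rewrite setUC.
Qed.

(** New bag vertices are not adjacent to [C], so keeping them does not constrain a solution inside
    [C]. *)
Lemma profile_weaken c B B' C F d : B \subset B' -> separated C (B' :\: B) ->
  (forall X j, d (X :&: B) j <= d X j) -> profile c C B F d -> profile c C B' F d.
Proof.
move=> BB' sC dd pr X j XB' Xj.
case: (pr (X :&: B) j) => [||S [R [[RS SC Rj cS sS] FS]]].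
- exact: subsetIr.
- by have := subset_leq_card (subsetIl X B); lia.
exists S, R; split; last by have := dd X j; lia.
split=> //; apply: separatedUl; first by apply: separatedS sS => //; apply: subsetUl.
rewrite -(setID X B); apply: separatedUl.
  by apply: separatedS sS => //; apply: subsetUr.
apply/separatedC; apply: separatedS sC; first exact: subset_trans (subsetDl _ _) SC.
exact: setSD.
Qed.

Definition hit Ms X := count (fun M => M :&: X != set0) Ms.
Definition weight x X := \sum_(q in X) x q.

Lemma hit0 Ms : hit Ms set0 = 0.
Proof. by rewrite /hit (eq_count (a2 := pred0)) ?count_pred0 // => M /=; rewrite setI0 eqxx. Qed.

Lemma weight0 x : weight x set0 = 0. Proof. by rewrite /weight big_set0. Qed.

Lemma weight1 x q : weight x [set q] = x q.
Proof. by rewrite /weight big_set1. Qed.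

Lemma weightU1 x w X : w \notin X -> weight x (w |: X) = x w + weight x X.
Proof. by move=> wX; rewrite /weight big_setU1. Qed.

Lemma weightD1 x w X : w \in X -> weight x X = x w + weight x (X :\ w).
Proof. by move=> wX; rewrite /weight (big_setD1 w). Qed.

Lemma setI1_neq0 M w : (M :&: [set w] != set0) = (w \in M).
Proof.
apply/set0Pn/idP=> [[z]|wM]; last by exists w; rewrite !inE wM eqxx.
by rewrite !inE => /andP[zM /eqP<-].
Qed.

Lemma hit1 Ms w : hit Ms [set w] = count (fun M : {set G} => w \in M) Ms.
Proof. by apply: eq_count => M /=; rewrite setI1_neq0. Qed.

Lemma hit_weaken Ms B X : all (fun M => M \subset B) Ms -> hit Ms (X :&: B) = hit Ms X.
Proof.
move=> /allP MB; apply: eq_in_count => M /MB MB' /=.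
by rewrite setIA setIAC (setIidPl MB').
Qed.

(** Breaks each set atom containing [w] into unit vertex atoms on its elements; [avoid] collects the
    sets left intact. *)
Definition dissolve x Ms w q := x q + count (fun M : {set G} => (w \in M) && (q \in M)) Ms.
Definition avoid Ms w := [seq M : {set G} <- Ms | w \notin M].

Lemma hitU1 Ms w X :
  hit Ms (w |: X) = hit Ms [set w] + hit (avoid Ms w) X.
Proof.
rewrite hit1 /hit /avoid count_filter -count_predUI [X in _ + X](eq_count (a2 := pred0)).
  rewrite count_pred0 addn0; apply: eq_count => M /=.
  by rewrite setIUr setU_eq0 negb_and setI1_neq0; case: (w \in M); rewrite /= ?andbT.
by move=> M /=; case: (w \in M); rewrite ?andbF.
Qed.

Lemma hit_split Ms w X : hit Ms X =
  count (fun M : {set G} => (w \in M) && (M :&: X != set0)) Ms + hit (avoid Ms w) X.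
Proof.
rewrite /hit /avoid count_filter -count_predUI [X in _ + X](eq_count (a2 := pred0)).
  rewrite count_pred0 addn0; apply: eq_count => M /=.
  by case: (w \in M); case: (_ != _).
by move=> M /=; case: (w \in M); rewrite ?andbF.
Qed.

Lemma weight_dissolve x Ms w X : weight (dissolve x Ms w) X =
  weight x X + \sum_(M <- Ms | w \in M) #|M :&: X|.
Proof.
rewrite /weight /dissolve big_split /=; congr (_ + _).
elim: Ms => [|M Ms IH]; first by rewrite big_nil big1.
rewrite big_split /= IH big_cons; case: (w \in M) => /=; last by rewrite big1.
congr (_ + _); rewrite -sum1_card big_mkcond [RHS]big_mkcond.
by apply: eq_bigr => q _; rewrite inE; case: (q \in M); case: (q \in X).
Qed.

(** A set containing [w] and met by [X] costs 1 as a set atom and [#|M :&: X|], at least 1, once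
    dissolved. *)
Lemma dissolve_ge x Ms w X :
  weight x X + hit Ms X <= weight (dissolve x Ms w) X + hit (avoid Ms w) X.
Proof.
rewrite (hit_split Ms w) weight_dissolve addnA leq_add2r leq_add2l.
elim: Ms => [|M Ms IH]; first by rewrite big_nil.
rewrite big_cons /=; case: (w \in M) => //=; apply: leq_add => //.
by case: eqVneq => //=; rewrite -card_gt0.
Qed.

End Profiles.

(** * c = 2 *)

Section Dissociation.
Variable G : sgraph.
Implicit Types (A B S R U X C D W N M : {set G}) (c j k F : nat) (q w : G).
Implicit Types (d : {set G} -> nat -> nat) (x : G -> nat) (Ms : seq {set G}).

Lemma profile_le c C B F d d' :
  (forall X j, X \subset B -> d X j <= d' X j) ->
  profile c C B F d -> profile c C B F d'.
Proof.
move=> dd pr X j XB Xj; have [S [R [h le]]] := pr X j XB Xj.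
by exists S, R; split=> //; have := dd X j XB; lia.
Qed.

Lemma weightS x X : weight (fun q => (x q).+1) X = weight x X + #|X|.
Proof. by rewrite /weight -sum1_card -big_split /=; apply: eq_bigr => q _; rewrite addn1. Qed.

Lemma weightDf x1 x2 X :
  weight (fun q => x1 q + x2 q) X = weight x1 X + weight x2 X.
Proof. exact: big_split. Qed.

Definition only B x q := if q \in B then x q else 0.

Lemma weight_only B x X : weight (only B x) X = weight x (X :&: B).
Proof.
rewrite /weight /only -big_mkcondr; apply: eq_bigl => q.
by rewrite inE.
Qed.

Lemma hit_cat Ms1 Ms2 X : hit (Ms1 ++ Ms2) X = hit Ms1 X + hit Ms2 X.
Proof. exact: count_cat. Qed.

Lemma avoid_id Ms w : hit Ms [set w] = 0 -> avoid Ms w = Ms.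
Proof.
move=> h; apply/all_filterP; rewrite all_predC has_count -hit1.
by rewrite h.
Qed.

Lemma hit_setD1 Ms w X : w \notin X -> hit [seq M :\ w | M <- Ms] X = hit Ms X.
Proof.
move=> wX; rewrite /hit count_map; apply: eq_count => M /=.
by congr (_ != _); apply/setP=> z; rewrite !inE; case: eqVneq => //= ->; rewrite (negPf wX) andbF.
Qed.

Lemma sum_setD1 Ms w : \sum_(M <- Ms) #|M|.+1 =
  \sum_(M <- [seq M :\ w | M <- Ms]) #|M|.+1 + hit Ms [set w].
Proof.
rewrite hit1; elim: Ms => [|M Ms IH]; first by rewrite !big_nil.
by rewrite /= !big_cons IH (cardsD1 w M); lia.
Qed.

(** Dissolving a set [M] containing [w] turns its price [#|M|.+1] into [#|M|.-1], one per remaining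
    vertex: a refund of 2. *)
Lemma sum_avoid Ms w B : all (fun M => M \subset B) Ms ->
  \sum_(M <- Ms) #|M|.+1 = \sum_(M <- avoid Ms w) #|M|.+1 +
    \sum_(M <- Ms | w \in M) #|M :&: (B :\ w)| + 2 * hit Ms [set w].
Proof.
rewrite hit1; elim: Ms => [|M Ms IH]; first by rewrite !big_nil.
case/andP=> MB /IH {}IH; rewrite /avoid /= -/(avoid Ms w) !big_cons IH.
have [wM|wM] := boolP (w \in M); rewrite /= ?big_cons; last by lia.
have -> : M :&: (B :\ w) = M :\ w by rewrite setIDA (setIidPl MB).
by rewrite (cardsD1 w M) wM; lia.
Qed.

(* An atom of [x] at [q] costs one kept vertex as soon as [q] is kept, unless
   it is merged with [q]; an atom of [Ms] costs one kept vertex as soon as it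
   is met. Each atom is paid for by the surplus (k + 2) F - 2 #|C|. *)
Definition price2 x Ms X j := weight x X - j + hit Ms X.

Definition inv2 k B C := exists F x Ms,
  [/\ profile 2 C B F (price2 x Ms), all (fun M => M \subset B) Ms
    & 2 * #|C| + weight x B + \sum_(M <- Ms) #|M|.+1 <= (k + 2) * F].

(** Eliminating [w] costs 2. Either [F] grows, which brings [k + 2], or [F] stays and the atoms at
    [w] refund 2. *)
Lemma inv2_forget k B C w : w \in B -> w \notin C -> #|B| <= k.+1 ->
  inv2 k B C -> inv2 k (B :\ w) (w |: C).
Proof.
move=> wB wC Bk [F [x [Ms [pr MB le]]]].
have Nk : #|B :\ w| <= k by rewrite (cardsD1 w) wB in Bk; lia.
have wX X : X \subset B :\ w -> w \notin X.
  by move=> XB; apply/negP=> /(subsetP XB); rewrite !inE eqxx.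
have wN := wX _ (subxx _); have wBE := weightD1 x wB.
have cC : #|w |: C| = #|C|.+1 by rewrite cardsU1 wC.
have MN Ms' : hit Ms' [set w] = 0 -> all (fun M => M \subset B) Ms' ->
    all (fun M => M \subset B :\ w) Ms'.
  move=> /avoid_id h /allP MB'; apply/allP=> M MMs.
  rewrite subsetD1 MB' //=; move: MMs; rewrite -h mem_filter; by case/andP.
(* With no set atom and at most one vertex atom at [w], a cluster of [w] and one more vertex absorbs
   the atom: [w] is kept without loss when [X] is empty. *)
have [/andP[xw /eqP m0]|] := boolP ((x w <= 1) && (hit Ms [set w] == 0)).
  have d1 : price2 x Ms [set w] 1 = 0 by rewrite /price2 weight1 m0; lia.
  have [xw0|xw1] := posnP (x w).
    (* The net gain [k] buys a vertex atom on each of the at most [k] remaining bag vertices. A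
       single kept vertex with room for one more takes [w]. *)
    exists F.+1, (fun q => (x q).+1), Ms; split; last 2 first.
    - exact: MN.
    - by rewrite weightS cC; nia.
    apply: profile_forget pr _ => // X j XN Xj.
    have [->|X0] := set_0Vmem X; first by apply: Or33; rewrite d1; split=> //; lia.
    have {}X0 : 0 < #|X| by rewrite card_gt0; apply/set0Pn; case: X0 => z; exists z.
    have [->|j0] := posnP j.
      by apply: Or31; rewrite /price2 weightS; lia.
    apply: Or32; split=> //; rewrite /price2 weightS weightU1 ?wX // hitU1 m0.
    by rewrite avoid_id //; lia.
  (* The vertex atom at [w] is released too, so [k + 1] is available, enough for a set atom on the
     remaining bag. *)
  exists F.+1, x, (B :\ w :: Ms); split; last 2 first.
  - by rewrite /= subxx MN.
  - by rewrite big_cons cC; nia.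
  apply: profile_forget pr _ => // X j XN Xj.
  have [->|X0] := eqVneq X set0; first by apply: Or33; rewrite d1; split=> //; lia.
  by apply: Or31; rewrite /price2 /hit /= (setIidPr XN) X0; lia.
rewrite negb_and -ltnNge -lt0n => big.
(* Two atoms at [w] refund 2 when [w] is deleted: a vertex atom disappears, a set loses one
   element. *)
have [m2|m1] := leqP 2 (x w + hit Ms [set w]).
  exists F, x, [seq M :\ w | M <- Ms]; split.
  - apply: profile_forget pr _ => // X j XN Xj.
    by apply: Or31; rewrite /price2 hit_setD1 ?wX.
  - by rewrite all_map; apply: sub_all MB => M /= MB; apply: setSD.
  - by move: le; rewrite (sum_setD1 Ms w) cC; lia.
have m_eq1 : hit Ms [set w] = 1 by lia.
have xw0 : x w = 0 by lia.
have av0 : hit (avoid Ms w) [set w] = 0.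
  rewrite hit1 /avoid count_filter (eq_count (a2 := pred0)) ?count_pred0 // => M /=.
  by case: (w \in M).
(* The only atom at [w] is one set, which is dissolved. If the kept vertex [q] lies in this set and
   has room, [w] joins [q], which makes up for the set being met. *)
exists F, (dissolve x Ms w), (avoid Ms w); split; last 2 first.
- by apply: MN => //; apply/allP=> M; rewrite mem_filter => /andP[_]; apply: (allP MB).
- by move: le; rewrite (sum_avoid w MB) weight_dissolve cC; lia.
apply: profile_forget pr _ => // X j XN Xj.
have [->|j0] := posnP j.
  by apply: Or31; rewrite /price2 !subn0 leq_add2l dissolve_ge.
have [->|X0] := eqVneq X set0.
  by apply: Or31; rewrite /price2 !weight0 !hit0.
have [q Xq] : exists q, X = [set q].
  by apply/cards1P/eqP; move: X0; rewrite -card_gt0; lia.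
have := hit_split Ms w [set q].
set e := count _ _ => hq.
have eE : e = count (fun M : {set G} => (w \in M) && (q \in M)) Ms.
  by apply: eq_count => M /=; rewrite setI1_neq0.
have e1 : e <= 1.
  by rewrite -m_eq1 hit1; apply: sub_count => M /andP[].
have [e0|e_gt0] := posnP e.
  by apply: Or31; rewrite Xq /price2 !weight1 /dissolve -eE; lia.
apply: Or32; split=> //; rewrite /price2 weightU1 ?wX // hitU1 m_eq1 Xq.
by rewrite !weight1 /dissolve -eE; rewrite Xq cards1 in Xj; lia.
Qed.

Lemma bag_inv2 k W B C : bag k W B C -> inv2 k B C.
Proof.
elim=> {B C} [B _ _|B C D hC IC hD ID CD sCD|B C w h IC wB sw|B B' C h IC BB' B'W B'k B'C].
- exists 0, (fun=> 0), [::]; split=> //; first exact: profile_nil.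
  by rewrite cards0 big_nil /weight big1.
- have [F1 [x1 [Ms1 [pr1 MB1 le1]]]] := IC; have [F2 [x2 [Ms2 [pr2 MB2 le2]]]] := ID.
  exists (F1 + F2), (fun q => x1 q + x2 q), (Ms1 ++ Ms2); split.
  + apply: profile_join pr1 pr2 _ => // X j _.
    exists (minn j (weight x1 X)), (j - minn j (weight x1 X)).
    by rewrite /price2 weightDf hit_cat; lia.
  + by rewrite all_cat MB1.
  + rewrite weightDf big_cat /= cardsU (disjoint_setI0 CD) cards0; lia.
- have [_ _ Bk BC _] := bag_facts h; apply: inv2_forget => //.
  by rewrite (disjointFr BC).
- have [F [x [Ms [pr MB le]]]] := IC.
  have [_ _ _ _ sC] := bag_facts h.
  (* [x] is uncontrolled outside the old bag [B], so it is reset to 0 there before the bag grows. *)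
  exists F, (only B x), Ms; split.
  + apply: (@profile_weaken _ _ B) => //.
    * apply: separatedS sC => //; apply/subsetP=> z; rewrite !inE.
      case/andP=> /negPf-> zB'; rewrite (subsetP B'W) // andbT /=.
      by rewrite (disjointFr B'C).
    * by move=> X j; rewrite /price2 hit_weaken // !weight_only -setIA setIid.
    * apply: profile_le pr => X j XB.
      by rewrite /price2 weight_only (setIidPl XB).
  + by apply/allP=> M /(allP MB) MB'; apply: subset_trans MB' BB'.
  + by rewrite weight_only (setIidPr BB').
Qed.

Lemma profile_solution c C B F d : profile c C B F d -> d set0 0 = 0 ->
  exists S, [/\ S \subset C, clustered c S & F <= #|S|].
Proof.
move=> pr d0; have [//||S [R [[RS SC + cS sS] FS]]] := pr set0 0 _ _.
- by rewrite sub0set.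
- by rewrite cards0.
rewrite leqn0 cards_eq0 => /eqP R0; exists S; split=> //; last by lia.
by rewrite R0 setD0 in cS.
Qed.

Lemma bag_dissociation k W : bag k W set0 W ->
  exists S, [/\ S \subset W, clustered 2 S & 2 * #|W| <= (k + 2) * #|S|].
Proof.
case/bag_inv2=> F [x [Ms [pr _ le]]].
have [|S [SW cS FS]] := profile_solution pr; first by rewrite /price2 weight0 hit0.
exists S; split=> //; apply: leq_trans (leq_mul (leqnn _) FS); lia.
Qed.

End Dissociation.

(** * k = 2 and c = 3 *)

Section ThreeClustered.
Variable G : sgraph.
Implicit Types (A B S R U X C D W N M : {set G}) (c j k F : nat) (q w : G).
Implicit Types (d : {set G} -> nat -> nat) (x : G -> nat) (Ms : seq {set G}).

Definition group_cost a := 7 * (a %/ 3) + 2 * (a %% 3) + 2 * minn 1 (a %% 3).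

Lemma group_cost_sub a b : group_cost (a + b) <= group_cost a + group_cost b.
Proof. rewrite /group_cost; lia. Qed.

(** [l] counts the set atoms, [m] those containing the forgotten vertex, [a] its vertex atoms, [b]
    and [a'] the vertex atoms on the rest of the bag before and after. Removing or dissolving three
    atoms frees the price 5 of the vertex. *)
Lemma group_cost_forget l m a b a' : m <= l -> 3 <= a + m -> a' <= b + m ->
  4 * l + group_cost (a + b) <= 14 ->
  5 + 4 * (l - m) + group_cost a' <= 4 * l + group_cost (a + b).
Proof. rewrite /group_cost; lia. Qed.

Definition price3 x Ms X j := weight x X + hit Ms X - j.

(* Any atom may merge with the kept vertices. An atom of [Ms] is paid 4;
   the atoms of [x] are paid in groups: 7 for three, 6 for two, 4 for one. *)
Definition inv3 B C := exists F x Ms,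
  [/\ profile 3 C B F (price3 x Ms),
      all (fun M => (M \subset B) && (#|M| <= 2)) Ms
    & 5 * #|C| + 4 * size Ms + group_cost (weight x B) <= 9 * F].

Lemma weight_sub x X B : X \subset B -> weight x X <= weight x B.
Proof. by move=> XB; rewrite /weight [leqRHS](big_setID X) /= (setIidPr XB) leq_addr. Qed.

Lemma size_avoid Ms w : size Ms = size (avoid Ms w) + hit Ms [set w].
Proof. by rewrite hit1 size_filter addnC -(count_predC (fun M : {set G} => w \in M)). Qed.

(** The bag has at most three vertices and so adds at most 15 to [5 * #|X|]. *)
Lemma chunk_over_bag W B C S : B \subset W -> C \subset W -> B :|: C != set0 ->
  #|B| <= 3 -> S \subset B :|: C -> clustered 3 S ->
  separated S (W :\: (B :|: C)) -> 5 * #|C| + 15 <= 9 * #|S| ->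
  exists X S, chunk 5 9 3 W X S.
Proof.
move=> BW CW ne B3 SBC cS sS le; exists (B :|: C), S; split=> //.
  by rewrite subUset BW.
by split=> //; have [] := leq_card_setU B C; lia.
Qed.

Lemma inv3_forget W B C w : bag 2 W B C -> w \in B ->
  separated (w |: C) (W :\: (B :|: C)) -> inv3 B C ->
  (exists X S, chunk 5 9 3 W X S) \/ inv3 (B :\ w) (w |: C).
Proof.
move=> h wB sw [F [x [Ms [pr MB le]]]].
have [BW CW Bk BC sC] := bag_facts h.
have wC : w \notin C by rewrite (disjointFr BC).
have ne : B :|: C != set0 by apply/set0Pn; exists w; rewrite inE wB.
have wX X : X \subset B :\ w -> w \notin X.
  by move=> XB; apply/negP=> /(subsetP XB); rewrite !inE eqxx.
have wBE := weightD1 x wB.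
have cC : #|w |: C| = #|C|.+1 by rewrite cardsU1 wC.
have wCBC : w |: C \subset B :|: C by rewrite subUset sub1set inE wB /= subsetUr.
(* At most two atoms at [w] can be absorbed by a cluster of three containing [w]. *)
have [n2|n3] := leqP (x w + hit Ms [set w]) 2.
  have d2 : price3 x Ms [set w] 2 = 0 by rewrite /price3 weight1; lia.
  have [c6|c5] := leqP 6 (4 * size Ms + group_cost (weight x B)).
    (* Keep [w] and delete the rest of the bag: [w] brings 9 and the surplus is at least 6, together
       the required 15. Only [X = set0] matters, so [d'] is made vacuous elsewhere. *)
    left; pose d' X j := if X == set0 then 0 else F.+1 + price3 x Ms X j.
    have pr' : profile 3 (w |: C) (B :\ w) F.+1 d'.
      apply: profile_forget pr _ => // X j XN Xj; rewrite /d'.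
      have [X0|X0] := eqVneq X set0; last exact/Or31/leq_addl.
      by apply: Or33; split=> //; rewrite d2 !addn0.
    have [|S [SC cS FS]] := profile_solution pr'; first by rewrite /d' eqxx.
    apply: (@chunk_over_bag W B C S) => //; first exact: subset_trans SC wCBC.
      exact: separatedS SC (subxx _) sw.
    by move: le c6 FS; clear; lia.
  right; have m1 : size Ms + weight x B <= 1 by move: c5; clear; rewrite /group_cost; lia.
  pose m := size Ms + weight x B.
  have pm X : X \subset B -> weight x X + hit Ms X <= m.
    move=> XB; have := weight_sub x XB.
    by have := count_size (fun M => M :&: X != set0) Ms; rewrite -/(hit Ms X) /m; clear; lia.
  (* There was at most one atom, of price 4 in either form, and [9 = 5 + 4] pays for [w] and one
     more. All become set atoms on the remaining bag, which has at most two vertices. *)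
  exists F.+1, (fun=> 0), (nseq m.+1 (B :\ w)); split; last 2 first.
  - rewrite all_nseq subxx /=; by move: Bk; rewrite (cardsD1 w) wB.
  - rewrite size_nseq /weight big1 // cC; move: le m1; rewrite /m /group_cost; clear; lia.
  apply: profile_forget pr _ => // X j XN Xj.
  have XB := subset_trans XN (subD1set _ _).
  have [X0|X0] := eqVneq X set0.
    by apply: Or33; split=> //; rewrite d2 addn0 leq_addr.
  have d'E i : price3 (fun=> 0) (nseq m.+1 (B :\ w)) X i = m.+1 - i.
    rewrite /price3 {1}/weight big1 // /hit count_nseq (setIidPr XN) X0.
    by rewrite mul1n.
  have [j0|j0] := posnP j.
    apply: Or31; rewrite d'E j0 /price3; have := pm X XB; clear; lia.
  apply: Or32; split=> //; rewrite d'E /price3.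
  have : w |: X \subset B by rewrite subUset sub1set wB.
  by move/pm; move: j0; clear; lia.
(* A surplus of 15 pays for deleting the whole bag; otherwise only [w] is deleted, and its atoms, at
   least three, are removed or dissolved. *)
have [c15|c14] := leqP 15 (4 * size Ms + group_cost (weight x B)).
  left; have [|S [SC cS FS]] := profile_solution pr.
    by rewrite /price3 weight0 hit0.
  apply: (@chunk_over_bag W B C S) => //; last by move: le c15 FS; clear; lia.
    exact: subset_trans SC (subsetUr _ _).
  exact: separatedS SC (subxx _) sC.
right; exists F, (dissolve x Ms w), (avoid Ms w); split.
- apply: profile_forget pr _ => // X j XN Xj.
  by apply: Or31; rewrite /price3; have := dissolve_ge x Ms w X; clear; lia.
- apply/allP=> M; rewrite mem_filter => /andP[wM /(allP MB)/andP[MB' M2]].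
  by rewrite subsetD1 MB' wM.
(* Sets have at most two elements, so each dissolved one leaves at most one vertex atom. *)
- have small : \sum_(M <- Ms | w \in M) #|M :&: (B :\ w)| <= hit Ms [set w].
    rewrite hit1 -sum1_count; elim: Ms MB {le pr n3 c14} => [|M Ms IH]; first by rewrite !big_nil.
    case/andP=> /andP[_ M2] /IH {}IH; rewrite !big_cons; case: ifP => // wM.
    apply: leq_add => //; rewrite (cardsD1 w) wM in M2.
    suff : #|M :&: (B :\ w)| <= #|M :\ w| by lia.
    apply: subset_leq_card; apply/subsetP=> z; rewrite !inE.
    by case/and3P=> -> ->.
  have sz := size_avoid Ms w; rewrite cC weight_dissolve.
  have := @group_cost_forget (size Ms) (hit Ms [set w]) (x w) (weight x (B :\ w))
    (weight x (B :\ w) + \sum_(M <- Ms | w \in M) #|M :&: (B :\ w)|).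
  by rewrite -wBE => /(_ _ n3 _ c14); move: le sz small; clear; lia.
Qed.

Lemma bag_inv3 W B C : bag 2 W B C ->
  (exists X S, chunk 5 9 3 W X S) \/ inv3 B C.
Proof.
elim=> {B C} [B _ _|B C D hC IC hD ID CD sCD|B C w h IC wB sw|B B' C h IC BB' B'W B'k B'C].
- right; exists 0, (fun=> 0), [::]; split=> //; first exact: profile_nil.
  by rewrite cards0 /weight big1.
- case: IC => [|[F1 [x1 [Ms1 [pr1 MB1 le1]]]]]; first by left.
  case: ID => [|[F2 [x2 [Ms2 [pr2 MB2 le2]]]]]; first by left.
  right; exists (F1 + F2), (fun q => x1 q + x2 q), (Ms1 ++ Ms2); split.
  + apply: profile_join pr1 pr2 _ => // X j _.
    pose i := minn j (weight x1 X + hit Ms1 X); exists i, (j - i).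
    by rewrite /price3 weightDf hit_cat /i; lia.
  + by rewrite all_cat MB1.
  + rewrite weightDf size_cat cardsU (disjoint_setI0 CD) cards0.
    by have := group_cost_sub (weight x1 B) (weight x2 B); lia.
- by case: IC => [|IC]; [left|apply: inv3_forget].
- case: IC => [|[F [x [Ms [pr MB le]]]]]; first by left.
  have [_ _ _ _ sC] := bag_facts h.
  have MB1 : all (fun M => M \subset B) Ms by apply: sub_all MB => M /andP[].
  right; exists F, (only B x), Ms; split.
  + apply: (@profile_weaken _ _ B) => //.
    * apply: separatedS sC => //; apply/subsetP=> z; rewrite !inE.
      case/andP=> /negPf-> zB'; rewrite (subsetP B'W) // andbT /=.
      by rewrite (disjointFr B'C).
    * by move=> X j; rewrite /price3 hit_weaken // !weight_only -setIA setIid.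
    * apply: profile_le pr => X j XB.
      by rewrite /price3 weight_only (setIidPl XB).
  + apply/allP=> M /(allP MB)/andP[MB' ->].
    by rewrite (subset_trans MB' BB').
  + by rewrite weight_only (setIidPr BB').
Qed.

Lemma bag_three_clustered W : bag 2 W set0 W -> W != set0 ->
  exists X S, chunk 5 9 3 W X S.
Proof.
move=> h W0; case: (bag_inv3 h) => // -[F [x [Ms [pr _ le]]]].
have [|S [SW cS FS]] := profile_solution pr; first by rewrite /price3 weight0 hit0.
exists W, S; split=> //; split; last by lia.
by rewrite setDv; apply/separatedC/separated0.
Qed.

End ThreeClustered.

(** * From tree decompositions to elimination *)

Section TreeToBag.
Variables (G T : sgraph) (Bt : T -> {set G}) (k : nat) (W : {set G}).
Hypothesis td : tree_decomposition Bt.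
Hypothesis Bk : forall t, #|Bt t| <= k.+1.
Implicit Types (A : {set T}) (s t : T) (v : G).

Let bt t := Bt t :&: W.
Definition span A := \bigcup_(s in A) bt s.

(** Stands for a rooted subtree without orienting the tree: [A] can be left only through its root
    [t]. *)
Definition branch A t := t \in A /\ forall s s', s \in A -> s' \notin A -> adj s s' -> s = t.

(** The nodes whose bag contains [v] are connected, so a property passed along edges between them
    reaches all of them. *)
Lemma bt_closed (P : pred T) v s s' : v \in Bt s -> v \in Bt s' -> P s ->
  (forall r r', P r -> adj r r' -> v \in Bt r -> v \in Bt r' -> P r') -> P s'.
Proof.
case: td => _ _ _ conn vs vs' Ps cl.
have hs : s \in [set t | v \in Bt t] by rewrite inE.
have hs' : s' \in [set t | v \in Bt t] by rewrite inE.
have := conn v (Sub s hs) (Sub s' hs').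
rewrite connect_induced /= => /connectP[p].
elim: p s {hs vs} Ps => [|r p IH] s Ps /=; first by move=> _ ->.
case/andP=> /and3P[sr + +] rp; rewrite !inE => vs vr.
exact: IH (cl _ _ Ps sr vs vr) rp.
Qed.

Lemma bag_forget_set (B C : {set G}) (F : seq G) : uniq F -> {subset F <= B} -> bag k W B C ->
  separated ([set v in F] :|: C) (W :\: (B :|: C)) ->
  bag k W (B :\: [set v in F]) ([set v in F] :|: C).
Proof.
elim: F B C => [|w F IH] B C /=.
  move=> _ _ + _; have -> : [set v in [::]] = set0 :> {set G} by apply/setP=> z; rewrite !inE.
  by rewrite setD0 set0U.
case/andP=> wF UF FB h; rewrite set_cons -setUA => s.
have wB : w \in B by apply: FB; rewrite inE eqxx.
have hw : bag k W (B :\ w) (w |: C).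
  apply: BagForget => //; apply: separatedS s => //; apply: setUS; exact: subsetUr.
have -> : B :\: (w |: [set v in F]) = (B :\ w) :\: [set v in F] by rewrite setDDl.
rewrite setUCA; apply: IH => //.
  move=> z zF; rewrite !inE FB ?inE ?zF ?orbT // andbT.
  by apply: contraNneq wF => <-.
rewrite setUCA; apply: separatedS s => //; apply: setDS; apply/subsetP=> z.
by rewrite !inE; case: eqVneq => [->|_] //=; rewrite ?wB ?orbT.
Qed.

(** Cut off the component [A2] of a neighbour [t'] of [t] in [A :\ t]. By induction both parts are
    eliminated down to the bags of [t'] and [t]; forgetting [bt t' :\: bt t] and then enlarging the
    bag to [bt t] allows a join. *)
Lemma branch_bag A t : branch A t -> bag k W (bt t) (span A :\: bt t).
Proof.
have [n] := ubnP #|A|; elim: n A t => // n IHn A t An [tA br].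
have [[T0 Tconn Tacyc] cov edg conn] := td.
have bk s : #|bt s| <= k.+1 by apply: leq_trans (Bk s); apply/subset_leq_card/subsetIl.
have [/existsP[t' /andP[t'A tt']]|/existsPn no] := boolP [exists t', (t' \in A) && adj t t'];
    last first.
  have At : A = [set t].
    apply/eqP; rewrite eqEsubset sub1set tA andbT; apply/subsetP=> s sA.
    rewrite inE; apply/negPn/negP=> st.
    have : s \in A :\ t by rewrite !inE st.
    suff : closed (@adj T) (mem (A :\ t)).
      by move/closed_connect=> /(_ _ _ (Tconn s t)) /= -> ; rewrite !inE eqxx.
    apply: intro_closed; first by move=> x y; rewrite (sym_connect_sym (@adj_sym T)).
    move=> x y xy /setD1P[xt xA]; apply/setD1P.
    have yA : y \in A.
      by apply: contraT => yA; rewrite (br x y xA yA xy) eqxx in xt.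
    split=> //; apply/eqP=> yt; have := no x; rewrite xA /= adj_sym -yt.
    by rewrite xy.
  rewrite At /span big_set1 setDv; apply: BagNil => //; exact: subsetIr.
pose e : rel T := radj (A :\ t).
pose A2 := [set s | connect e t' s].
have t't : t' != t.
  by apply/eqP=> E; move: tt'; rewrite E adj_irrefl.
have t'A2 : t' \in A2 by rewrite inE connect0.
have A2A : A2 \subset A :\ t.
  apply/subsetP=> s; rewrite inE => /connectP[p].
  case/lastP: p => [|p z] /=; first by move=> _ ->; rewrite !inE t't.
  by rewrite rcons_path last_rcons => /andP[_ /and3P[_ _ zS]] ->.
have out s s' : s \in A2 -> s' \notin A2 -> adj s s' -> s' = t.
  move=> sA2 s'A2 ss'; have /setD1P[st sA] := subsetP A2A _ sA2.
  have s'A : s' \in A.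
    by apply: contraT => s'A; rewrite (br s s' sA s'A ss') eqxx in st.
  apply/eqP; apply: contraNT s'A2 => s't; move: sA2; rewrite !inE => /connect_trans.
  by apply; apply: connect1; rewrite /e /radj /= ss' !inE st sA s't s'A.
have tA2 : t \notin A2 by apply/negP=> /(subsetP A2A); rewrite !inE eqxx.
(* A second edge from [A2] to [t] would close a cycle with a path from [t'] inside [A2]. *)
have attach s : s \in A2 -> adj s t -> s = t'.
  move=> sA2 st; apply/eqP; apply/negPn/negP=> st'.
  move: (sA2); rewrite inE => /connectP[p0 p0e sE].
  have [p [pe Up {}sE]] : exists p, [/\ path e t' p, uniq (t' :: p) & s = last t' p].
    by case/shortenP: p0e sE => p pe Up _ ->; exists p.
  have pA2 : {subset t' :: p <= A2}.
    move=> z; rewrite inE => /predU1P[->//|zp]; rewrite inE.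
    by apply: (path_connect pe); rewrite inE zp orbT.
  have : ucycle (@adj T) (t :: t' :: p).
    apply/andP; split.
      rewrite /= tt' rcons_path -sE st andbT.
      by apply: sub_path pe => x y /and3P[].
    by rewrite cons_uniq Up andbT; apply: contra tA2 => /pA2.
  move/Tacyc; case: (p) sE => //= E; by rewrite E eqxx in st'.
pose A1 := A :\: A2.
have A2s : #|A2| < #|A|.
  apply: leq_ltn_trans (subset_leq_card A2A) _.
  by rewrite [ltnRHS](cardsD1 t) tA.
have A1s : #|A1| < #|A|.
  rewrite cardsD (setIidPr _); last exact: subset_trans A2A (subD1set _ _).
  have : 0 < #|A2| by rewrite card_gt0; apply/set0Pn; exists t'.
  have : #|A2| <= #|A| by apply: ltnW.
  by lia.
have br1 : branch A1 t.
  split; first by rewrite inE tA2.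
  move=> s s' /setDP[sA sA2]; rewrite inE negb_and negbK => /orP[s'A2|s'A] ss'.
    by apply: (out s' s) => //; rewrite adj_sym.
  exact: br s s' sA s'A ss'.
have br2 : branch A2 t'.
  split=> // s s' sA2 s'A2 ss'; apply: attach => //.
  by rewrite -(out s s').
have h1 : bag k W (bt t) (span A1 :\: bt t) by apply: IHn br1; lia.
have h2 : bag k W (bt t') (span A2 :\: bt t') by apply: IHn br2; lia.
have only2 v s s' : s \in A2 -> v \in Bt s -> v \notin Bt t -> v \in Bt s' -> s' \in A2.
  move=> sA2 vs vt vs'; apply: (bt_closed (P := mem A2) vs vs') => //= r r' rA2 rr' _ vr'.
  apply: contraT => r'A2; move: vt; rewrite -(out r r') // vr'; done.
(* The nodes containing [v] connect [A2] to [t], which is possible only through [t']. *)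
have through v s : s \in A2 -> v \in Bt s -> v \in Bt t -> v \in Bt t'.
  move=> sA2 vs vt; apply: contraT => vt'.
  have : t \in A2.
    apply: (bt_closed (P := mem A2) vs vt) => //= r r' rA2 rr' vr vr'.
    apply: contraT => r'A2; have r't := out _ _ rA2 r'A2 rr'.
    move: vt'; rewrite -(attach r) ?vr // -r't //.
  by rewrite (negPf tA2).
have spanP (B : {set T}) v :
    reflect (exists2 s, s \in B & (v \in Bt s) && (v \in W)) (v \in span B).
  apply: (iffP bigcupP) => -[s sB]; first by rewrite inE; exists s.
  by move=> vs; exists s => //; rewrite inE.
pose F := [seq v <- enum (bt t') | v \notin bt t].
have FE : [set v in F] = bt t' :\: bt t.
  by apply/setP=> v; rewrite [in LHS]inE mem_filter mem_enum [in RHS]inE.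
have span2W v : v \in span A2 -> v \in W by case/spanP=> s _ /andP[].
have CE : (bt t' :\: bt t) :|: (span A2 :\: bt t') = span A2 :\: bt t.
  apply/setP=> v; rewrite !in_setU !in_setD.
  have [v2|v2] := boolP (v \in span A2); rewrite ?andbT ?andbF ?orbF.
    have [vt|vt] /= := boolP (v \in bt t); last by case: (v \in bt t').
    have /spanP[s sA2 /andP[vs vW]] := v2.
    by move: vt; rewrite !inE vW !andbT => vt; rewrite (through v s).
  have -> : v \in bt t' = false; last by rewrite andbF.
  by apply: contraNF v2 => vt'; apply/bigcupP; exists t'.
have sep2 : separated (span A2 :\: bt t) (W :\: (bt t :|: span A2)).
  move=> u v /setDP[/spanP[s sA2 /andP[us uW]] ut] /setDP[vW]; rewrite inE negb_or => /andP[_ v2].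
  apply: contraNN v2 => uv; have [r /andP[ur vr]] := edg u v uv.
  apply/spanP; exists r; last by rewrite vr.
  by apply: (only2 u s) => //; apply: contra ut => ut; rewrite inE ut.
have h2' : bag k W (bt t' :\: (bt t' :\: bt t)) (span A2 :\: bt t).
  rewrite -CE -FE; apply: bag_forget_set => //.
  - exact/filter_uniq/enum_uniq.
  - by move=> v; rewrite mem_filter mem_enum => /andP[].
  rewrite FE CE => u v uC /setDP[vW]; rewrite !inE negb_or vW andbT => /andP[vt' v2].
  have [vt|vt] := boolP (v \in Bt t).
    apply: contraT; rewrite negbK => uv; have [r /andP[ur vr]] := edg u v uv.
    case/setDP: uC => /spanP[s sA2 /andP[us uW]] ut.
    have rA2 : r \in A2.
      by apply: (only2 u s) => //; apply: contra ut => ut; rewrite inE ut.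
    by rewrite (through v r) in vt'.
  apply: sep2 => //; rewrite !inE vW (negPf vt) /= andbT.
  by move: v2; rewrite vt'.
have spanA : span A :\: bt t = (span A1 :\: bt t) :|: (span A2 :\: bt t).
  rewrite -setDUl; congr (_ :\: _); rewrite /span -bigcup_setU.
  by congr (\bigcup_(i in _) _); rewrite setUC -(setIidPr (subset_trans A2A (subD1set _ _))) setID.
rewrite spanA; apply: BagJoin => //.
- apply: BagWeaken h2' _ _ _ _ => //.
  + by rewrite setDDr setDv set0U subsetIr.
  + exact: subsetIr.
  + by rewrite disjoint_sym disjoints_subset setDE subsetIr.
- rewrite -setI_eq0; apply/eqP/setP=> v; rewrite [RHS]inE; apply/negP.
  case/setIP=> /setDP[/spanP[s /setDP[_ sA2] /andP[vs vW]] vt] /setDP[/spanP[s' s'A2 /andP[vs' _]] _].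
  move: sA2; rewrite (only2 v s') //; apply: contra vt => vt; by rewrite inE vt.
- apply/separatedC; apply: separatedS sep2 => //; apply/subsetP=> v.
  case/setDP=> /spanP[s /setDP[_ sA2] /andP[vs vW]] vt; rewrite in_setD in_setU vW andbT negb_or vt /=.
  apply: contra sA2 => /spanP[s' s'A2 /andP[vs' _]].
  apply: (only2 v s') => //; apply: contra vt => vt; by rewrite inE vt.
Qed.

(** The whole tree is a branch at any of its nodes; the bag of this root is forgotten last. *)
Lemma decomposition_bag : bag k W set0 W.
Proof.
have [[T0 Tconn Tacyc] cov edg conn] := td.
have [t _] : exists t : T, t \in T by apply/card_gt0P.
have h : bag k W (bt t) (span setT :\: bt t).
  by apply: branch_bag; split=> [|s s' _]; rewrite !inE.
have spanW : span setT = W.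
  apply/setP=> v; apply/bigcupP/idP=> [[s _]|vW]; first by rewrite inE => /andP[].
  by have [s vs] := cov v; exists s; rewrite // inE vs.
have /= := @bag_forget_set (bt t) (W :\: bt t) (enum (bt t)).
have -> : [set v in enum (bt t)] = bt t by apply/setP=> v; rewrite inE mem_enum.
have E : bt t :|: (W :\: bt t) = W.
  by rewrite setDE setUIr setUCr setIT; apply/setUidPr/subsetIr.
rewrite setDv E; apply.
- exact: enum_uniq.
- by move=> v; rewrite mem_enum.
- by rewrite -{2}spanW.
- by rewrite setDv; apply/separatedC/separated0.
Qed.

End TreeToBag.

Lemma treewidth_bag (G : sgraph) (W : {set G}) : bag (treewidth G) W set0 W.
Proof.
rewrite /treewidth; case: ex_minnP => w /boolp.asboolP[T [Bt [td wE]]] _.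
apply: (decomposition_bag W td) => t.
by rewrite -wE /width; have := @leq_bigmax _ (fun s => #|Bt s|) t; lia.
Qed.


(** * Lower bounds on [alpha] in terms of the treewidth *)

Section LowerBounds.
Variable G : sgraph.

Lemma alpha_ge c (S : {set G}) : clustered c S -> #|S| <= alpha c G.
Proof. by move=> cS; apply: (@leq_bigmax_cond _ (fun S => clustered c S)). Qed.

Lemma alpha_ratio p q c :
  (forall W : {set G}, W != set0 -> exists X S, chunk p q c W X S) ->
  p * #|G| <= q * alpha c G.
Proof.
move=> h; case: (@greedy G p q c setT) => [U _|S [_ cS le]]; first exact: h.
rewrite cardsT in le; apply: leq_trans le _.
by rewrite leq_mul2l alpha_ge // orbT.
Qed.

Lemma alpha_ratio_general c : 0 < c ->
  c * #|G| <= (treewidth G + c + 1) * alpha c G.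
Proof.
move=> c0; apply: alpha_ratio => W W0.
case: (bag_chunk_general c0 (treewidth_bag W)) => // Wc.
exists W, W; split=> //; first exact/clustered_small/ltnW.
split; first by rewrite setDv; apply/separatedC/separated0.
by rewrite leq_mul2r; lia.
Qed.

(** The final bag is empty, so nothing can hang at it and a nonempty [W] must yield a chunk. *)
Lemma alpha_ratio_tree c : 0 < c -> treewidth G = 1 ->
  c * #|G| <= (1 + c) * alpha c G.
Proof.
move=> c0 tw; apply: alpha_ratio => W W0.
have := treewidth_bag W; rewrite tw => /(bag_chunk_tree c0)[//|[f [WE _]]].
by rewrite WE big_set0 eqxx in W0.
Qed.

Lemma chunk_independent (W : {set G}) : W != set0 ->
  exists X S, chunk 1 (treewidth G + 1) 1 W X S.
Proof.
move=> W0; case: (bag_chunk_one (treewidth_bag W)) => // WE.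
by rewrite WE eqxx in W0.
Qed.

Lemma alpha_ratio_one : #|G| <= (treewidth G + 1) * alpha 1 G.
Proof. by rewrite -[leqLHS]mul1n; apply/alpha_ratio/chunk_independent. Qed.

Lemma alpha_ratio_two : 2 * #|G| <= (treewidth G + 2) * alpha 2 G.
Proof.
have [S [_ cS le]] := bag_dissociation (treewidth_bag [set: G]).
rewrite cardsT in le; apply: leq_trans le _.
by rewrite leq_mul2l alpha_ge // orbT.
Qed.

Lemma alpha_ratio_three : treewidth G = 2 -> 5 * #|G| <= 9 * alpha 3 G.
Proof.
move=> tw; apply: alpha_ratio => W W0.
by apply: bag_three_clustered W0; have := treewidth_bag W; rewrite tw.
Qed.

(* A clique has no two independent vertices, while a subset of order [k + 1] of
   a graph of treewidth less than [k] has. *)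
Lemma treewidth_clique k (K : {set G}) : #|K| = k.+1 ->
  {in K &, forall u v, u != v -> adj u v} -> k <= treewidth G.
Proof.
move=> Kk cl; rewrite leqNgt; apply/negP=> tw.
have [S [SK cS le]] : exists S : {set G},
    [/\ S \subset K, clustered 1 S & 1 * #|K| <= (treewidth G + 1) * #|S|].
  by apply: greedy => U _; apply: chunk_independent.
have /card_gt1P[u [v [uS vS uv]]] : 1 < #|S| by rewrite Kk in le; nia.
have := @clustered_path G 1 S u [:: v] cS.
rewrite /= inE uv (cl u v) ?(subsetP SK) //= => /(_ isT isT) h.
by suff : 2 <= 1 by []; apply: h => z; rewrite !inE => /orP[]/eqP->.
Qed.

End LowerBounds.

(** * Treewidth of graphs on ['I_n] with a parent function *)

Section EliminationTree.
Variables (n : nat) (e : rel nat) (parent : nat -> nat).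
Hypothesis e_sym : symmetric e.
Hypothesis e_irrefl : irreflexive e.
Hypothesis parent_lt : forall v, 0 < v -> parent v < v.
Hypothesis parent_adj : forall u v, u < v -> e u v ->
  (u == parent v) || (u < parent v) && e u (parent v).

Fact nat_adj_sym : symmetric [rel u v : 'I_n | e u v].
Proof. by move=> u v; apply: e_sym. Qed.
Fact nat_adj_irrefl : irreflexive [rel u v : 'I_n | e u v].
Proof. by move=> u; apply: e_irrefl. Qed.
Definition nat_graph := SGraph nat_adj_sym nat_adj_irrefl.

Definition tree_adj : rel 'I_n :=
  [rel u v : 'I_n | (0 < u) && (v == parent u :> nat) || (0 < v) && (u == parent v :> nat)].
Fact tree_adj_sym : symmetric tree_adj.
Proof. by move=> u v; rewrite /tree_adj /= orbC. Qed.
Fact tree_adj_irrefl : irreflexive tree_adj.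
Proof.
move=> u; rewrite /tree_adj /= orbb; apply/negP=> /andP[/parent_lt + /eqP E].
by rewrite -E ltnn.
Qed.
Definition tree_graph := SGraph tree_adj_sym tree_adj_irrefl.

Lemma parent_ord (v : 'I_n) : 0 < v -> {w : 'I_n | w = parent v :> nat /\ tree_adj v w}.
Proof.
move=> v0; have lt : parent v < n := ltn_trans (parent_lt v0) (ltn_ord v).
by exists (Ordinal lt); split=> //; rewrite /tree_adj /= v0 eqxx.
Qed.

Lemma tree_adj_lt (u v : 'I_n) : tree_adj u v -> v <= u -> v = parent u :> nat.
Proof.
case/orP=> /andP[u0 /eqP] // E; have := parent_lt u0; rewrite -E; lia.
Qed.

Lemma tree_graph_tree : 0 < n -> is_tree tree_graph.
Proof.
move=> n0; split; first by rewrite card_ord.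
- have root : forall u : tree_graph, connect (@adj tree_graph) u (Ordinal n0).
    move=> u; have [m] := ubnP (u : 'I_n); elim: m u => // m IH u um.
    have [u0|u0] := posnP (u : 'I_n).
      by rewrite (_ : u = Ordinal n0) ?connect0 //; apply: val_inj.
    have [w [wE uw]] := parent_ord u0; apply: connect_trans (connect1 uw) _.
    by apply: IH; rewrite wE; have := parent_lt u0; move: um; lia.
  move=> u v; apply: connect_trans (root u) _.
  by rewrite (sym_connect_sym (@adj_sym tree_graph)).
- move=> p pc; rewrite ltnNge; apply/negP=> p3.
  (* The largest vertex of a cycle would have two distinct smaller neighbours, while its only
     smaller neighbour is its parent. *)
  have [t tp tmax] : exists2 t : tree_graph, t \in p & forall u, u \in p -> (u : 'I_n) <= (t : 'I_n).
    case: p p3 {pc} => // t0 p _; have t0p : t0 \in t0 :: p by rewrite mem_head.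
    case: (@arg_maxnP tree_graph t0 (mem (t0 :: p)) (fun u => (u : 'I_n) : nat) t0p) => t tp tm.
    by exists t.
  have [i q pE] := rot_to tp.
  have : ucycle (@adj tree_graph) (t :: q) by rewrite -pE rot_ucycle.
  have szq : size q = (size p).-1 by rewrite -(size_rot i p) pE.
  have qp u : u \in q -> u \in p by move=> uq; rewrite -(mem_rot i) pE inE uq orbT.
  case: q szq qp {pE} => [|a q] szq qp; first by move: szq p3 => /=; lia.
  case/andP=> /= /andP[ta]; rewrite rcons_path => /andP[_ lt] /and3P[_ aq _].
  have q0 : q != [::].
    by case: q szq {qp lt aq} => //=; move: p3; case: (size p) => [|[|[|]]].
  have lq : last a q \in q by case: q q0 {szq qp lt aq} => //= b q _; apply: mem_last.
  have aE := tree_adj_lt ta (tmax _ (qp _ (mem_head _ _))).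
  have lE : last a q = parent t :> nat.
    apply: tree_adj_lt; first by rewrite tree_adj_sym.
    by apply/tmax/qp; rewrite inE lq orbT.
  by move: aq; rewrite (_ : a = last a q) ?lq //; apply: val_inj; rewrite /= aE lE.
Qed.

Definition down_bag (t : 'I_n) : {set 'I_n} :=
  [set u : 'I_n | (u == t :> nat) || (u < t) && e u t].

(** By [parent_adj], a vertex of [down_bag t] other than [t] also lies in the bag of the parent of
    [t]. Hence climbing from [t] stays among the nodes containing [v] until it arrives at [v]. *)
Lemma down_bag_decomposition : 0 < n -> @tree_decomposition nat_graph tree_graph down_bag.
Proof.
move=> n0; split; first exact: tree_graph_tree.
- by move=> v; exists v; rewrite inE eqxx.
- move=> u v uv; case: (ltngtP (u : 'I_n) (v : 'I_n)) => [lt|lt|E].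
  + by exists v; rewrite !inE eqxx lt (uv : e u v) orbT.
  + by exists u; rewrite !inE eqxx lt e_sym (uv : e u v) orbT.
  + by move: uv; rewrite (_ : u = v) ?adj_irrefl //; apply: val_inj.
move=> v; set Z := [set t | _].
have vZ : (v : tree_graph) \in Z by rewrite !inE eqxx.
have root (t : tree_graph) : t \in Z -> connect (radj Z) t v.
  have [m] := ubnP (t : 'I_n); elim: m t => // m IH t tm tZ.
  move: (tZ); rewrite !inE => /orP[/eqP E|/andP[vt evt]].
    by rewrite (_ : v = t) ?connect0 //; apply: val_inj.
  have t0 : 0 < (t : 'I_n) by apply: leq_ltn_trans vt.
  have [w [wE tw]] := parent_ord t0.
  have wZ : (w : tree_graph) \in Z by rewrite !inE wE; apply: parent_adj.
  apply: connect_trans (IH w _ wZ); first by apply: connect1; apply/and3P.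
  by rewrite wE; have := parent_lt t0; move: tm; lia.
have symZ : symmetric (radj Z).
  by move=> s t; rewrite /radj /= tree_adj_sym; case: (s \in Z); case: (t \in Z); rewrite ?andbF.
move=> x y; rewrite connect_induced; apply: connect_trans (root _ (valP x)) _.
by rewrite (sym_connect_sym symZ); apply: root; apply: valP.
Qed.

Lemma nat_graph_treewidth k : 0 < n ->
  (forall v : 'I_n, #|[set u : 'I_n | (u < v) && e u v]| <= k) ->
  treewidth nat_graph <= k.
Proof.
move=> n0 h; rewrite /treewidth; case: ex_minnP => w _ /(_ (@width nat_graph tree_graph down_bag)) wmin.
apply: leq_trans (wmin _) _.
  by apply/boolp.asboolP; exists tree_graph, down_bag; split=> //; apply: down_bag_decomposition.
rewrite /width -subn1 leq_subLR add1n.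
apply/bigmax_leqP=> t _.
have -> : down_bag t = (t : 'I_n) |: [set u : 'I_n | (u < (t : 'I_n)) && e u (t : 'I_n)].
  by apply/setP=> u; rewrite !inE.
by apply: leq_trans (leq_card_setU _ _) _; rewrite cards1; apply: h.
Qed.

Variable S : {set nat_graph}.

(** Membership in [S] for all naturals, false from [n] on, so that [S] can be counted along
    intervals [iota]. *)
Definition picked (v : nat) : bool := v \in [seq val u | u <- enum S].

Lemma card_picked : #|S| = count picked (iota 0 n).
Proof.
rewrite cardE -(size_map val) -size_filter; apply/perm_size/uniq_perm.
- by rewrite map_inj_uniq ?enum_uniq //; apply: val_inj.
- exact/filter_uniq/iota_uniq.
move=> v; rewrite mem_filter mem_iota add0n /= -/(picked v).
by case pv: (picked v) => //=; case/mapP: pv => u _ ->; rewrite ltn_ord.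
Qed.

Lemma picked_path c x s : clustered c S -> path e x s -> uniq (x :: s) ->
  all picked (x :: s) -> size (x :: s) <= c.
Proof.
move=> cS xs Ux pk.
have [l lE] : exists l : seq 'I_n, x :: s = map val l.
  elim: {xs Ux} (x :: s) pk => [|y l IH] /=; first by exists [::].
  by case/andP=> /mapP[u _ ->] /IH[l' ->]; exists (u :: l').
case: l lE => [|u l] //= [xE sE]; rewrite sE size_map.
apply: (@clustered_path nat_graph c S u l cS).
- by move: xs; rewrite xE sE path_map.
- by move: Ux; rewrite xE sE -[_ :: _]/(map val (u :: l)) map_inj_uniq //; apply: val_inj.
- move=> v vl; have /(allP pk)/mapP[w wS] : val v \in x :: s.
    by rewrite xE sE -[_ :: _]/(map val (u :: l)) map_f.
  by move/val_inj->; rewrite mem_enum in wS.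
Qed.

End EliminationTree.

(** * Extremal graphs *)

Section PathPowers.
Variables (k c m : nat).
Hypotheses (c0 : 0 < c) (m0 : 0 < m).

(** Disjoint copies of the [k]-th power of a path on [k + c] vertices; the quotient by [k + c] is
    the index of the copy. *)
Definition power_adj : rel nat := fun u v =>
  [&& u != v, u %/ (k + c) == v %/ (k + c), u <= v + k & v <= u + k].

Fact power_sym : symmetric power_adj.
Proof.
by move=> u v; rewrite /power_adj eq_sym [_ %/ _ == _]eq_sym [(_ <= _) && _]andbC.
Qed.
Fact power_irrefl : irreflexive power_adj.
Proof. by move=> u; rewrite /power_adj eqxx. Qed.

Definition power_graph := nat_graph (m * (k + c)) power_sym power_irrefl.

Lemma card_power_graph : #|power_graph| = m * (k + c).
Proof. exact: card_ord. Qed.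

Lemma card_ord_lt n j : j <= n -> #|[set u : 'I_n | u < j]| = j.
Proof.
by move=> jn; rewrite -sum1dep_card (big_ord_narrow jn) sum_nat_const card_ord muln1.
Qed.

Lemma treewidth_power_graph : treewidth power_graph = k.
Proof.
have n0 : k.+1 <= m * (k + c) by nia.
apply/eqP; rewrite eqn_leq; apply/andP; split.
  apply: (@nat_graph_treewidth _ _ predn) => [[|v] //|u v uv||v].
  - case/and4P=> _ /eqP E _ vk.
    case: (eqVneq u v.-1) => //= uv1.
    have uv2 : u < v.-1 by move: uv uv1; case: v {E vk} => //= v; lia.
    rewrite uv2 /power_adj neq_ltn uv2 /=; apply/and3P; split; try by lia.
    rewrite eqn_leq leq_div2r ?E ?leq_div2r //; lia.
  - lia.
  - rewrite cardE -(size_map val) -[leqRHS](size_iota (v - k)).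
    apply: uniq_leq_size; first by rewrite map_inj_uniq ?enum_uniq //; apply: val_inj.
    move=> z /mapP[u]; rewrite mem_enum inE => /andP[uv /and4P[_ _ _ vk]] ->.
    by rewrite mem_iota; apply/andP; split; move: uv vk => /=; lia.
apply: (@treewidth_clique power_graph k [set u : 'I_(m * (k + c)) | u < k.+1]).
  by rewrite card_ord_lt.
move=> u v; rewrite !inE => uk vk uv; apply/and4P; split.
- by [].
- by rewrite !divn_small //; lia.
- lia.
- lia.
Qed.

Lemma path_ltn_last x s : path ltn x s -> x + size s <= last x s.
Proof.
elim: s x => [|y s IH] x /=; first by rewrite addn0.
by case/andP=> xy /IH; lia.
Qed.

(** Every step advances by at least 1, so a gap above [k] would push the last entry to [hi] or
    beyond. *)
Lemma path_small_gaps hi x s : path ltn x s -> last x s < hi ->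
  hi <= x + size s + k -> path [rel u v | u < v <= u + k] x s.
Proof.
elim: s x => //= y s IH x /andP[xy ys] lt le; rewrite xy /=.
have := path_ltn_last ys => ls; apply/andP; split; first by lia.
by apply: IH => //; lia.
Qed.

(** More than [c] of [k + c] consecutive vertices leave no gap above [k] and so form a path in [S]
    that is too long. *)
Lemma count_power_block (S : {set power_graph}) i : clustered c S ->
  count (picked S) (iota (i * (k + c)) (k + c)) <= c.
Proof.
move=> cS; rewrite -size_filter; set l : seq nat := filter _ _.
have srt : sorted ltn l by apply: sorted_filter (iota_ltn_sorted _ _); apply: ltn_trans.
have lP (v : nat) : v \in l -> picked S v /\ i * (k + c) <= v < i * (k + c) + (k + c).
  by rewrite mem_filter mem_iota => /andP[].
rewrite leqNgt; apply/negP=> big.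
case: l lP srt big => // x s lP xs; rewrite [size _]/= ltnS => big.
have xl : last x s \in x :: s by apply: mem_last.
have [_ /andP[xlo _]] := lP x (mem_head _ _); have [_ /andP[_ lhi]] := lP _ xl.
have gaps : path [rel u v | u < v <= u + k] x s.
  by apply: (path_small_gaps xs lhi); lia.
have : size (x :: s) <= c.
  apply: (@picked_path _ _ _ _ S c x s cS).
  - pose Q := [pred v | v \in x :: s].
    have : all Q (x :: s) by apply/allP.
    move=> aQ; apply: (sub_in_path (P := Q) _ aQ gaps) => u v uQ vQ /= /andP[uv vk].
    have [_ /andP[u1 u2]] := lP u uQ; have [_ /andP[v1 v2]] := lP v vQ.
    apply/and4P; split; try by lia.
    have dE z : i * (k + c) <= z < i * (k + c) + (k + c) -> z %/ (k + c) = i.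
      case/andP=> z1 z2; rewrite -(subnKC z1) divnMDl; last by lia.
      by rewrite divn_small ?addn0 //; lia.
    by rewrite !dE ?u1 ?v1.
  - exact: sorted_uniq ltn_trans ltnn _ xs.
  - by apply/allP=> v /lP[].
by rewrite leqNgt /= ltnS big.
Qed.

Lemma alpha_power_graph : alpha c power_graph <= m * c.
Proof.
apply/bigmax_leqP=> S cS; rewrite (card_picked S).
suff h i : count (picked S) (iota 0 (i * (k + c))) <= i * c by apply: h.
elim: i => // i IH; rewrite !mulSnr iotaD count_cat add0n.
exact: leq_add IH (count_power_block i cS).
Qed.

End PathPowers.

(** * The square of a path with added vertices of degree two: ratio 5/9 *)

Section LeafySquare.
Variable m : nat.

(* Block [i] occupies [9 i, ..., 9 i + 8]: seven consecutive vertices of the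
   square of a path, then a vertex joined to the first and third of them and
   one joined to the second and fourth.  Truncated subtraction in block 0
   produces no spurious edge because [leafy_adj] requires [u < v]. *)
Definition leafy_down v := let b := 9 * (v %/ 9) in
  nth [::] [:: [:: b - 4; b - 3]; [:: b - 3; b]; [:: b; b + 1]; [:: b + 1; b + 2];
    [:: b + 2; b + 3]; [:: b + 3; b + 4]; [:: b + 4; b + 5]; [:: b; b + 2];
    [:: b + 1; b + 3]] (v %% 9).

Definition leafy_adj : rel nat := fun u v =>
  (u < v) && (u \in leafy_down v) || (v < u) && (v \in leafy_down u).

Definition leafy_parent v := last 0 (leafy_down v).

Lemma leafy_downE i r : r < 9 -> leafy_down (9 * i + r) = let b := 9 * i in
  nth [::] [:: [:: b - 4; b - 3]; [:: b - 3; b]; [:: b; b + 1]; [:: b + 1; b + 2];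
    [:: b + 2; b + 3]; [:: b + 3; b + 4]; [:: b + 4; b + 5]; [:: b; b + 2];
    [:: b + 1; b + 3]] r.
Proof.
move=> r9; have dE : (9 * i + r) %/ 9 = i by lia.
have mE : (9 * i + r) %% 9 = r by lia.
by rewrite /leafy_down dE mE.
Qed.

Lemma leafy_down0 i : leafy_down (9 * i) = [:: 9 * i - 4; 9 * i - 3].
Proof. by rewrite -[9 * i]addn0 leafy_downE // addn0. Qed.

Fact leafy_sym : symmetric leafy_adj.
Proof. by move=> u v; rewrite /leafy_adj orbC. Qed.
Fact leafy_irrefl : irreflexive leafy_adj.
Proof. by move=> u; rewrite /leafy_adj ltnn. Qed.

Lemma leafy_split v : exists i r, v = 9 * i + r /\ r < 9.
Proof. by exists (v %/ 9), (v %% 9); rewrite ltn_mod mulnC -divn_eq. Qed.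

Lemma leafy_parent_lt v : 0 < v -> leafy_parent v < v.
Proof.
have [i [r [-> r9]]] := leafy_split v; rewrite /leafy_parent leafy_downE //.
by do 9 (case: r r9 => [|r] r9 //=; first by lia).
Qed.

Lemma leafy_parent_adj u v : u < v -> leafy_adj u v ->
  (u == leafy_parent v) || (u < leafy_parent v) && leafy_adj u (leafy_parent v).
Proof.
move=> uv; rewrite /leafy_adj uv ltnNge (ltnW uv) orbF /= => uD.
suff : (u == leafy_parent v) || (u < leafy_parent v) && (u \in leafy_down (leafy_parent v)).
  by case/orP=> [->//|/andP[-> ->]]; rewrite orbT.
have [i [r [vE r9]]] := leafy_split v; subst v.
move: uD; rewrite /leafy_parent leafy_downE //.
case: r r9 uv => [|r] r9 uv.
  rewrite /= !inE => /orP[]/eqP E; last by rewrite E eqxx.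
  case: i uv E => [|i] uv E; first by move: uv; rewrite E; lia.
  have -> : 9 * i.+1 - 3 = 9 * i + 6 by lia.
  by rewrite leafy_downE //= !inE; move: E; lia.
have D0 := leafy_down0 i; have D1 := @leafy_downE i 1 isT.
have D2 := @leafy_downE i 2 isT; have D3 := @leafy_downE i 3 isT.
have D4 := @leafy_downE i 4 isT; have D5 := @leafy_downE i 5 isT.
move: D1 D2 D3 D4 D5 => /= D1 D2 D3 D4 D5.
case: r r9 uv => [|r] r9 uv; first by rewrite /= D0 !inE; lia.
case: r r9 uv => [|r] r9 uv; first by rewrite /= D1 !inE; lia.
case: r r9 uv => [|r] r9 uv; first by rewrite /= D2 !inE; lia.
case: r r9 uv => [|r] r9 uv; first by rewrite /= D3 !inE; lia.
case: r r9 uv => [|r] r9 uv; first by rewrite /= D4 !inE; lia.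
case: r r9 uv => [|r] r9 uv; first by rewrite /= D5 !inE; lia.
case: r r9 uv => [|r] r9 uv; first by rewrite /= D2 !inE; lia.
case: r r9 uv => [|r] r9 uv; first by rewrite /= D3 !inE; lia.
by [].
Qed.

Definition leafy_graph := nat_graph (9 * m) leafy_sym leafy_irrefl.

Lemma card_leafy_graph : #|leafy_graph| = 9 * m.
Proof. exact: card_ord. Qed.

Lemma treewidth_leafy_graph : 0 < m -> treewidth leafy_graph = 2.
Proof.
move=> m0; apply/eqP; rewrite eqn_leq; apply/andP; split.
  apply: (nat_graph_treewidth _ _ leafy_parent_lt leafy_parent_adj); first by lia.
  move=> v; rewrite cardE -(size_map val).
  have sz : size (leafy_down v) = 2.
    have [i [r [-> r9]]] := leafy_split v; rewrite leafy_downE //.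
    by do 9 (case: r r9 => [|r] r9 //).
  apply: leq_trans (_ : _ <= size (leafy_down v)) _; last by rewrite sz.
  apply: uniq_leq_size; first by rewrite map_inj_uniq ?enum_uniq //; apply: val_inj.
  move=> z /mapP[u]; rewrite mem_enum inE => /andP[uv] + ->.
  by rewrite /leafy_adj uv ltnNge (ltnW uv) orbF.
apply: (@treewidth_clique leafy_graph 2 [set u : 'I_(9 * m) | u < 3]).
  by rewrite card_ord_lt //; lia.
move=> u v; rewrite !inE => u3 v3 uv.
suff : leafy_adj u v by [].
have : (u : 'I_(9 * m)) != v :> nat by [].
by case: (val u) u3 => [|[|[|]]] //; case: (val v) v3 => [|[|[|]]].
Qed.

(** A block preceded by the last two path vertices of the block before it: these are 0 and 1, the
    path of the block is 2 to 8, and its two added vertices are 9 and 10. *)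
Definition window_down j := nth [::] [:: [::]; [:: 0]; [:: 0; 1]; [:: 1; 2];
  [:: 2; 3]; [:: 3; 4]; [:: 4; 5]; [:: 5; 6]; [:: 6; 7]; [:: 2; 4]; [:: 3; 5]] j.
Definition window_adj i j := (i \in window_down j) || (j \in window_down i).
Definition window_paths := [:: [:: 2; 3; 4; 5]; [:: 6; 7; 5; 10]; [:: 0; 1; 2; 9];
  [:: 9; 4; 3; 10]; [:: 2; 4; 6; 8]; [:: 3; 5; 6; 8]; [:: 0; 1; 3; 10];
  [:: 9; 2; 3; 10]; [:: 9; 4; 5; 10]; [:: 7; 6; 4; 9]; [:: 0; 1; 2; 4];
  [:: 0; 1; 3; 5]; [:: 8; 6; 5; 10]; [:: 2; 3; 4; 6]; [:: 2; 3; 5; 6];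
  [:: 8; 6; 4; 9]].

Fixpoint masks n : seq (seq bool) :=
  if n is n'.+1 then map (cons true) (masks n') ++ map (cons false) (masks n')
  else [:: [::]].

Lemma mem_masks l : l \in masks (size l).
Proof.
elim: l => //= b l IH; rewrite mem_cat.
by case: b; rewrite map_f // orbT.
Qed.

(** The pairs 0, 1 and 7, 8 are the last two path vertices of consecutive blocks, so the error of
    one unit telescopes along the blocks. *)
Definition window_ok (b : nat -> bool) :=
  all (fun q => ~~ all b q) window_paths ==>
  (count b (iota 2 9) + (b 0 && b 1) <= 5 + (b 7 && b 8)).

Lemma window_okP b : window_ok b.
Proof.
(* All [2 ^ 11] selections are computed. [window_ok] reads only indices below 11, so tabulating [b]
   does not change it. *)
have h : all (fun l => window_ok (nth false l)) (masks 11) by vm_compute.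
exact: allP h _ (mem_masks (mkseq b 11)).
Qed.

Definition window_vertex i j := if j is j'.+2 then 9 * i + j' else 9 * i - 4 + j.

Lemma window_adj_leafy i j j' : (1 < j') || (0 < i) -> j < 11 ->
  j' \in window_down j -> leafy_adj (window_vertex i j') (window_vertex i j).
Proof.
move=> h j11 jj'; rewrite /leafy_adj; apply/orP; left.
case: j j11 jj' => [|[|j]] // j11.
  rewrite inE => /eqP E; move: h; rewrite E; case: i => // i _.
  have -> : window_vertex i.+1 1 = 9 * i + 6 by rewrite /window_vertex; lia.
  by rewrite (@leafy_downE i 6 isT) /window_vertex /= !inE; lia.
have Dj := @leafy_downE i j j11.
rewrite [window_vertex i j.+2]/= Dj => {Dj}.
by do 9 (case: j j11 => [|j] j11;
  first by rewrite /= !inE => /orP[]/eqP E; move: h; rewrite E /window_vertex /= ?inE; lia).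
Qed.

Lemma count_leafy_block (S : {set leafy_graph}) i : clustered 3 S ->
  count (picked S) (iota (9 * i) 9) +
    [&& 0 < i, picked S (9 * i - 4) & picked S (9 * i - 3)] <=
  5 + (picked S (9 * i + 5) && picked S (9 * i + 6)).
Proof.
move=> cS.
(* Block 0 has no predecessor; the guard discards indices 0 and 1 there, which truncated subtraction
   would send to vertices of the block itself. *)
pose b j := ((1 < j) || (0 < i)) && picked S (window_vertex i j).
have := window_okP b; rewrite /window_ok.
have -> : count b (iota 2 9) = count (picked S) (iota (9 * i) 9).
  by rewrite /b /= !addn0 !addnS !addn0.
have -> : b 0 && b 1 = [&& 0 < i, picked S (9 * i - 4) & picked S (9 * i - 3)].
  rewrite /b /window_vertex /= addn0; case: (posnP i) => //= i0.
  by congr (_ && picked S _); lia.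
have -> : b 7 && b 8 = picked S (9 * i + 5) && picked S (9 * i + 6) by [].
move/implyP; apply; apply/allP=> q qP; apply/negP=> bq.
have qw : [&& size q == 4, uniq q, all (fun j => j < 11) q & sorted window_adj q].
  by move: q qP {bq}; apply/allP.
case/and4P: qw => /eqP q4 Uq q11 qs.
have allb j : j \in q -> [/\ (1 < j) || (0 < i), picked S (window_vertex i j) & j < 11].
  by move=> jq; have /andP[? ?] := allP bq j jq; have := allP q11 j jq.
case: q q4 Uq qs allb {qP bq q11} => // x s q4 Uq qs allb.
have : size (map (window_vertex i) (x :: s)) <= 3.
  apply: (@picked_path _ _ _ _ S 3) => //.
  - rewrite path_map; pose Q := [pred v | v \in x :: s].
    have aQ : all Q (x :: s) by apply/allP.
    apply: (sub_in_path (P := Q) _ aQ qs) => u v uQ vQ.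
    have [hu _ u11] := allb u uQ; have [hv _ v11] := allb v vQ.
    by case/orP=> h; last rewrite /= leafy_sym; apply: window_adj_leafy.
  - rewrite -[_ :: _]/(map (window_vertex i) (x :: s)) map_inj_in_uniq // => u v uq vq.
    have [hu _ u11] := allb u uq; have [hv _ v11] := allb v vq.
    by rewrite /window_vertex; case: u hu u11 {uq} => [|[|u]]; case: v hv v11 {vq} => [|[|v]] //=; lia.
  - by apply/allP=> z /(@mapP _ _ (window_vertex i) (x :: s))[j /allb[]] _ + _ ->.
by rewrite size_map q4.
Qed.

Lemma alpha_leafy_graph : alpha 3 leafy_graph <= 5 * m + 1.
Proof.
apply/bigmax_leqP=> S cS; rewrite (card_picked S).
suff h i : count (picked S) (iota 0 (9 * i)) <=
    5 * i + [&& 0 < i, picked S (9 * i - 4) & picked S (9 * i - 3)].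
  by apply: leq_trans (h m) _; rewrite leq_add2l leq_b1.
elim: i => [|i IH]; first by [].
rewrite mulnSr iotaD count_cat add0n.
have -> : 9 * i + 9 - 4 = 9 * i + 5 by lia.
have -> : 9 * i + 9 - 3 = 9 * i + 6 by lia.
rewrite ltn0Sn andTb; apply: leq_trans (leq_add IH (leqnn _)) _.
by rewrite -addnA [_ + count _ _]addnC mulnSr -addnA leq_add2l count_leafy_block.
Qed.

End LeafySquare.

(** * Limits *)

Import Order.TTheory GRing.Theory Num.Theory.

Local Open Scope ring_scope.

Section Limit.
Variable R : realType.

Lemma limn_einf_supE (u : nat -> \bar R) :
  limn_einf u = ereal_sup (range (einfs u)).
Proof. by rewrite limn_einf_lim; apply/cvg_lim => //; apply: cvg_einfs_sup. Qed.

Lemma limn_einf_ge (u : nat -> \bar R) (l : \bar R) N :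
  (forall n, (N <= n)%N -> (l <= u n)%E) -> (l <= limn_einf u)%E.
Proof.
move=> lu; rewrite limn_einf_supE; apply: (@le_trans _ _ (einfs u N)).
  by apply: le_ereal_inf_tmp => _ [n /= Nn <-]; apply: lu.
by apply: ereal_sup_ubound; exists N.
Qed.

Lemma limn_einf_le (u : nat -> \bar R) (l : \bar R) :
  (forall N, exists2 n, (N <= n)%N & (u n <= l)%E) -> (limn_einf u <= l)%E.
Proof.
move=> ul; rewrite limn_einf_supE; apply: ge_ereal_sup => _ [N _ <-].
have [n Nn un] := ul N; apply: le_trans un.
by apply: ereal_inf_lbound; exists n.
Qed.

Lemma xkc_ge k c p q : (0 < q)%N ->
  (forall G : sgraph, treewidth G = k -> (p * #|G| <= q * alpha c G)%N) ->
  ((p%:R / q%:R)%:E <= xkc R k c)%E.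
Proof.
(* Starting at order 1 avoids the denominator 0. *)
move=> q0 h; apply: (@limn_einf_ge _ _ 1%N) => n n0.
apply: le_ereal_inf_tmp => _ [G [Gn tw ->]]; rewrite lee_fin.
rewrite ler_pdivrMr ?ltr0n // mulrAC ler_pdivlMr ?ltr0n // -!natrM ler_nat.
by rewrite -Gn [leqRHS]mulnC; apply: h.
Qed.

(** The orders [m * q] alone bound the lower limit, and the additive error [a] vanishes after
    division. *)
Lemma xkc_le k c p q a : (0 < q)%N ->
  (forall m, (0 < m)%N -> exists G : sgraph,
    [/\ #|G| = (m * q)%N, treewidth G = k & (alpha c G <= m * p + a)%N]) ->
  (xkc R k c <= (p%:R / q%:R)%:E)%E.
Proof.
move=> q0 h; apply/lee_addgt0Pr => e e0; apply: limn_einf_le => N.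
(* [m] exceeds both [N] and [a / e], so that [a <= e * m <= e * (m * q)]. *)
pose m := (maxn N (Num.bound (a%:R / e))).+1.
have [G [Gn tw al]] := h m isT.
exists (m * q)%N.
  by apply: leq_trans (leq_pmulr _ q0); rewrite ltnW // ltnS leq_maxl.
apply: (@le_trans _ _ ((alpha c G)%:R / (m * q)%:R)%:E).
  by apply: ereal_inf_lbound; exists G.
have q0' : 0 < q%:R :> R by rewrite ltr0n.
have m0' : 0 < m%:R :> R by rewrite ltr0n.
rewrite -EFinD lee_fin ler_pdivrMr; last by rewrite ltr0n muln_gt0.
apply: (@le_trans _ _ (m * p + a)%:R); first by rewrite ler_nat.
rewrite mulrDl !natrM natrD natrM mulrCA divfK ?gt_eqF //.
rewrite lerD2l; apply: (@le_trans _ _ (e * m%:R)).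
  rewrite mulrC -ler_pdivrMr //; apply: ltW.
  apply: lt_le_trans (archi_boundP _) _; first by rewrite divr_ge0 ?ler0n // ltW.
  by rewrite ler_nat /m ltnW // ltnS leq_maxr.
by rewrite mulrA ler_peMr ?mulr_ge0 ?ler0n ?(ltW e0) // ler1n.
Qed.

Lemma xkc_le_power k c : (0 < c)%N -> (xkc R k c <= (c%:R / (k + c)%:R)%:E)%E.
Proof.
move=> c0; apply: (@xkc_le _ _ _ _ 0); first by rewrite addn_gt0 c0 orbT.
move=> m m0; exists (power_graph k c m); split.
- exact: card_power_graph.
- exact: treewidth_power_graph.
- by rewrite addn0; apply: alpha_power_graph.
Qed.

Lemma xkc_le_leafy : (xkc R 2 3 <= (5 / 9)%:E)%E.
Proof.
apply: (@xkc_le _ _ 5 9 1) => // m m0; exists (leafy_graph m); split.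
- by rewrite mulnC; apply: card_leafy_graph.
- exact: treewidth_leafy_graph.
- by rewrite mulnC; apply: alpha_leafy_graph.
Qed.

End Limit.

Theorem theorem1 (R : realType) :
  [/\ forall k c : nat, (1 <= k)%N -> (1 <= c)%N ->
        ((c%:R / (k + c + 1)%:R)%:E <= xkc R k c)%E /\
        (xkc R k c <= (c%:R / (k + c)%:R)%:E)%E,
      forall c : nat, (1 <= c)%N ->
        xkc R 1 c = (c%:R / (1 + c)%:R)%:E,
      forall k : nat, (1 <= k)%N ->
        xkc R k 1 = (1 / (k + 1)%:R)%:E /\ xkc R k 2 = (2 / (k + 2)%:R)%:E
    & xkc R 2 3 = (5 / 9)%:E].
Proof.
split=> [k c _ c0|c c0|k _|].
- split; last exact: xkc_le_power.
  by apply: xkc_ge => [|G <-]; [rewrite addn1|apply: alpha_ratio_general].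
(* For [k = 1] here, and for [c = 1] and [c = 2] below, the general upper bound is already the exact
   value. *)
- apply/le_anti; rewrite xkc_le_power //=.
  by apply: xkc_ge => // G; apply: alpha_ratio_tree.
- split; apply/le_anti; rewrite xkc_le_power //=.
    apply: (@xkc_ge _ _ _ 1) => [|G <-]; first by rewrite addn1.
    by rewrite mul1n; apply: alpha_ratio_one.
  by apply: xkc_ge => [|G <-]; [rewrite addn2|apply: alpha_ratio_two].
- apply/le_anti; rewrite xkc_le_leafy /=.
  by apply: (@xkc_ge _ _ _ 5 9) => // G; apply: alpha_ratio_three.
Qed.
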